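(* Let $c\in\mathbb{R}$ with $c^2\neq 1$, let $\gamma=1/(c^2-1)$, and let $f$ be a periodic traveling wave of the sine-Gordon equation with speed $c$ and energy $E$. Then: (i) if $f$ is subluminal and rotational, $f$ is (temporally spectrally) stable; (ii) if $f$ is superluminal and rotational, $f$ is unstable; (iii) if $f$ is librational (subluminal or superluminal), $f$ is unstable.
   Context: Sine-Gordon equation: $u_{tt}-u_{xx}+\sin u=0$. A traveling wave of speed $c$ ($c^2\neq1$) is $u(x,t)=f(x-ct)$ where $f:\mathbb{R}\to\mathbb{R}$ solves $(c^2-1)f''+\sin f=0$; it satisfies $\tfrac12(c^2-1)(f')^2+1-\cos f=E$ for a constant $E$ (the energy). The wave is subluminal if $c^2<1$ and superluminal if $c^2>1$. It is librational if $0<E<2$, and rotational if $E<0$ (subluminal case) or $E>2$ (superluminal case); these are the periodic traveling waves, and $T>0$ denotes the smallest positive number with $f(z+T)=f(z)\pmod{2\pi}$ for all $z$. Set $\gamma=1/(c^2-1)$. The spectral problem (P) is $p''-2c\gamma\lambda p'+\gamma(\lambda^2+\cos f(z))p=0$, $\lambda\in\mathbb{C}$; its spectrum $\sigma(\mathrm{P})$ is the set of $\lambda\in\mathbb{C}$ for which (P) has a nontrivial solution bounded on $\mathbb{R}$. The wave $f$ is (temporally spectrally) stable if $\sigma(\mathrm{P})$ contains no $\lambda$ with $\operatorname{Re}\lambda>0$, and unstable otherwise. *)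

(* Defs.v *)
From Stdlib Require Import Reals.
From Coquelicot Require Import Coquelicot.
Open Scope R_scope.

Definition gam (c : R) : R := / (c ^ 2 - 1).

Definition traveling_wave (c : R) (f : R -> R) : Prop :=
  (forall z, ex_derive f z /\ ex_derive (Derive f) z) /\
  (forall z, (c ^ 2 - 1) * Derive (Derive f) z + sin (f z) = 0).

Definition has_energy (c : R) (f : R -> R) (E : R) : Prop :=
  forall z, / 2 * (c ^ 2 - 1) * (Derive f z) ^ 2 + 1 - cos (f z) = E.

Definition subluminal (c : R) : Prop := c ^ 2 < 1.
Definition superluminal (c : R) : Prop := c ^ 2 > 1.
Definition librational (E : R) : Prop := 0 < E < 2.
Definition rotational (c E : R) : Prop :=
  (subluminal c /\ E < 0) \/ (superluminal c /\ E > 2).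
Definition periodic_tw (c E : R) : Prop := librational E \/ rotational c E.

Definition in_spectrum (c : R) (f : R -> R) (lam : C) : Prop :=
  exists p p1 p2 : R -> C,
    (forall z, is_derive p z (p1 z) /\ is_derive p1 z (p2 z) /\
       (p2 z - RtoC (2 * c * gam c) * lam * p1 z
        + RtoC (gam c) * (lam * lam + RtoC (cos (f z))) * p z = 0)%C) /\
    (exists M : R, forall z, Cmod (p z) <= M) /\
    (exists z, p z <> 0%C).

Definition spectrally_stable (c : R) (f : R -> R) : Prop :=
  forall lam : C, in_spectrum c f lam -> Re lam <= 0.

(* Main.v *)
(* (i) [f'] is a zero-free solution of [phi'' + gam c * cos f * phi = 0], which makes the
   linearized energy density of a solution [exp (lam t) p] nonnegative.  If [Re lam > 0] this
   density is, up to the factor [Re lam], the derivative of a flux whose square it dominates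
   when [p] is bounded, and a Riccati inequality on the whole line forces [p = 0].

   (ii), (iii) Removing the first-order term turns (P) into a Lame equation with a single gap,
   which has the explicit solutions [p = exp (int L)] with [L = c gam lam + (X' + W) / (2 X)],
   where [X = cos f + b], [b = E - 1 + 2 gam lam^2] and [W^2 = 4 gam^2 lam^2 (b^2 - 1)].
   In a suitable phase [theta], [cos f] is affine in [cos theta] and
   [theta' = sqrt (k (m + a cos theta))], so [p] is bounded as soon as the mean of
   [Re (c gam lam + W / (2 X))] over a period of [theta] vanishes.
   - Superluminal: move [lam] in the open first quadrant along [b = a - 1 + i tau], [tau > 0].
     As [tau -> 0], [lam] tends to a point of the imaginary axis inside the gap, where the
     growth of the Hill solution dominates; as [tau -> oo] the factor [|c| > 1] dominates.
   - Subluminal librational: real [lam] with [b = - 1 - t], [t >= 0], suffices; the growth of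
     the Hill solution is zero at [t = 0], and beats [|c| < 1] as [t -> oo].
   In both cases the intermediate value theorem gives an unstable [lam]. *)
Require Import Defs.
From Stdlib Require Import ZArith Reals Lra Lia.
From Coquelicot Require Import Coquelicot.
Open Scope R_scope.

(** * Derivatives of complex-valued functions of a real variable *)

Lemma is_derive_C (p : R -> C) (z : R) (l : C) :
  is_derive p z l <->
  is_derive (fun t => Re (p t)) z (Re l) /\ is_derive (fun t => Im (p t)) z (Im l).
Proof.
split.
- intros H; split.
  + unfold is_derive in *.
    apply (filterdiff_ext_lin _ (fun y : R => fst (scal y l))).
    * apply (filterdiff_comp' p (fst : C -> R) z _ fst H).
      apply filterdiff_linear, is_linear_fst.
    * reflexivity.
  + unfold is_derive in *.
    apply (filterdiff_ext_lin _ (fun y : R => snd (scal y l))).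
    * apply (filterdiff_comp' p (snd : C -> R) z _ snd H).
      apply filterdiff_linear, is_linear_snd.
    * reflexivity.
- intros [Hr Hi].
  apply (is_derive_ext (fun t => plus (scal (Re (p t)) (1, 0) : C) (scal (Im (p t)) (0, 1) : C))).
  + intros t; apply injective_projections; simpl;
    unfold plus, scal, mult; simpl; unfold Re, Im, mult; simpl; ring.
  + replace l with (plus (scal (Re l) (1, 0) : C) (scal (Im l) (0, 1) : C)).
    * apply (is_derive_plus (V := C_R_NormedModule)).
      -- apply (is_derive_scal_l (V := C_R_NormedModule) _ _ _ _ Hr).
      -- apply (is_derive_scal_l (V := C_R_NormedModule) _ _ _ _ Hi).
    * apply injective_projections; simpl;
      unfold plus, scal, mult; simpl; unfold Re, Im, mult; simpl; ring.
Qed.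

(** * Stability of subluminal rotational waves *)

(* [auto_derive] expresses the derivative of an abstract function through [Derive]. *)
Ltac derive_subst H :=
  match type of H with
  | is_derive ?g ?z ?l =>
    let h := eval cbv beta in (fun t : R => g t) in
    replace (Derive h z) with l
      by (symmetry; exact (is_derive_unique _ _ _ H))
  end.

Lemma derive_nonneg_incr (F dF : R -> R) (x y : R) :
  (forall z, x <= z <= y -> is_derive F z (dF z)) -> (forall z, x <= z <= y -> 0 <= dF z) ->
  x <= y -> F x <= F y.
Proof.
intros HF Hd Hxy.
destruct (MVT_gen F x y dF) as [t [Ht Heq]].
- intros z Hz; apply HF; rewrite Rmin_left, Rmax_right in Hz; lra.
- intros z Hz; apply continuity_pt_filterlim, (ex_derive_continuous (V := R_NormedModule)).
  rewrite Rmin_left, Rmax_right in Hz by lra; eexists; apply HF; lra.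
- rewrite Rmin_left, Rmax_right in Ht by lra.
  assert (0 <= dF t * (y - x)) by (apply Rmult_le_pos; [apply Hd; lra | lra]); lra.
Qed.

Lemma derive_zero_const (h : R -> R) :
  (forall x, is_derive h x 0) -> forall x y, h x = h y.
Proof.
intros Hh.
assert (Hle : forall x y, x <= y -> h x = h y).
{ intros x y Hxy; apply Rle_antisym.
  - apply (derive_nonneg_incr h (fun _ => 0)); auto; intros; lra.
  - assert (H : - h x <= - h y); [|lra].
    apply (derive_nonneg_incr (fun x => - h x) (fun _ => 0)); auto.
    + intros t _; replace 0 with (- 0) by ring.
      apply (is_derive_opp (V := R_NormedModule)), Hh.
    + intros; lra. }
intros x y; destruct (Rle_lt_dec x y) as [H|H]; [auto | symmetry; apply Hle; lra].
Qed.

(** A positive solution of [y' = k y^2] blows up in finite time to the right: once [F] is positive,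
    [- / F z - k * z] is nondecreasing, although [- / F] stays below 0. *)
Lemma riccati_nonpos (F dF : R -> R) (k : R) :
  0 < k -> (forall z, is_derive F z (dF z)) -> (forall z, k * F z ^ 2 <= dF z) ->
  forall z, F z <= 0.
Proof.
intros Hk HF Hd z0; destruct (Rle_lt_dec (F z0) 0) as [|Hpos]; [easy|exfalso].
assert (Hinc : forall z, z0 <= z -> F z0 <= F z).
{ intros z Hz; apply (derive_nonneg_incr F dF); auto.
  intros t _; apply Rle_trans with (2 := Hd t); nra. }
(* Blow-up point of the solution of [y' = k y^2] that starts from [F z0] at [z0]. *)
pose (z1 := z0 + / (k * F z0)).
assert (Hz : z0 <= z1).
{ assert (0 < / (k * F z0)) by (apply Rinv_0_lt_compat; nra); unfold z1; lra. }
assert (H : - / F z0 - k * z0 <= - / F z1 - k * z1).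
{ apply (derive_nonneg_incr (fun z => - / F z - k * z) (fun z => dF z / F z ^ 2 - k)); auto.
  - intros z [Hz' _]; specialize (Hinc z Hz').
    auto_derive; [repeat split; [eexists; apply HF | lra] |].
    derive_subst (HF z); field; lra.
  - intros z [Hz' _]; specialize (Hinc z Hz').
    assert (0 < F z ^ 2) by (apply pow_lt; lra).
    assert (k <= dF z / F z ^ 2) by (apply Rle_div_r; [lra | apply Hd]); lra. }
assert (k * (z1 - z0) = / F z0) by (unfold z1; field; split; lra).
assert (0 < / F z1) by (apply Rinv_0_lt_compat; specialize (Hinc z1 Hz); lra).
lra.
Qed.

(** The reflected function [- F (- z)] obeys the same inequality, so the one-sided bound applies to
    both. *)
Lemma riccati_zero (F dF : R -> R) (k : R) :
  0 < k -> (forall z, is_derive F z (dF z)) -> (forall z, k * F z ^ 2 <= dF z) ->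
  forall z, F z = 0.
Proof.
intros Hk HF Hd z; apply Rle_antisym.
- apply (riccati_nonpos F dF k); auto.
- assert (H : - F (- (- z)) <= 0).
  { apply (riccati_nonpos (fun t => - F (- t)) (fun t => dF (- t)) k); auto.
    - intros t; auto_derive; [eexists; apply HF |].
      derive_subst (HF (- t)); ring.
    - intros t; specialize (Hd (- t)); nra. }
  rewrite Ropp_involutive in H; lra.
Qed.

Lemma traveling_wave_derive (c : R) (f : R -> R) :
  c ^ 2 <> 1 -> traveling_wave c f ->
  forall z, is_derive f z (Derive f z) /\ is_derive (Derive f) z (- gam c * sin (f z)).
Proof.
intros Hc [Hd Heq] z; destruct (Hd z) as [H1 H2]; split.
- now apply Derive_correct.
- replace (- gam c * sin (f z)) with (Derive (Derive f) z); [now apply Derive_correct|].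
  specialize (Heq z); unfold gam.
  apply Rmult_eq_reg_l with (c ^ 2 - 1); [|lra].
  replace ((c ^ 2 - 1) * (- / (c ^ 2 - 1) * sin (f z))) with (- sin (f z)) by (field; lra); lra.
Qed.

Lemma is_derive_Re (p : R -> C) (z : R) (l : C) :
  is_derive p z l -> is_derive (fun t => Re (p t)) z (Re l).
Proof. intros H; now apply is_derive_C in H. Qed.

Lemma is_derive_Im (p : R -> C) (z : R) (l : C) :
  is_derive p z l -> is_derive (fun t => Im (p t)) z (Im l).
Proof. intros H; now apply is_derive_C in H. Qed.

(* [r = phi'/phi] for a zero-free solution [phi] of [phi'' + gam c * V * phi = 0]. With
   [s = p' - r p], the energy density is [e = |lam p|^2 + (1 - c^2) |s|^2], and the flux is
   [F = c |lam p|^2 + (1 - c^2) Re (conj lam * s * conj p)], so that [F' = Re lam * e]. *)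
Lemma bounded_solution_trivial (c : R) (V r : R -> R) (lam : C) (p p1 p2 : R -> C) (M : R) :
  c ^ 2 < 1 -> 0 < Re lam ->
  (forall z, is_derive r z (- gam c * V z - r z ^ 2)) ->
  (forall z, is_derive p z (p1 z) /\ is_derive p1 z (p2 z) /\
     (p2 z - RtoC (2 * c * gam c) * lam * p1 z
      + RtoC (gam c) * (lam * lam + RtoC (V z)) * p z = 0)%C) ->
  (forall z, Cmod (p z) <= M) ->
  forall z, p z = 0%C.
Proof.
intros Hc Hlam Hr Hp HM.
destruct lam as [x y]; simpl in Hlam.
pose (n := x ^ 2 + y ^ 2). pose (kap := 1 - c ^ 2).
assert (Hn : 0 < n) by (unfold n; nra).
assert (Hk : 0 < kap) by (unfold kap; lra).
pose (u z := Re (p z)). pose (v z := Im (p z)).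
pose (u1 z := Re (p1 z)). pose (v1 z := Im (p1 z)).
pose (s z := u1 z - r z * u z). pose (t z := v1 z - r z * v z).
pose (e z := n * (u z ^ 2 + v z ^ 2) + kap * (s z ^ 2 + t z ^ 2)).
pose (F z := c * n * (u z ^ 2 + v z ^ 2)
  + kap * (x * (s z * u z + t z * v z) + y * (t z * u z - s z * v z))).
assert (Hu : forall z, is_derive u z (u1 z)) by (intros z; apply is_derive_Re, Hp).
assert (Hv : forall z, is_derive v z (v1 z)) by (intros z; apply is_derive_Im, Hp).
assert (Hu1 : forall z, is_derive u1 z
  (2 * c * gam c * (x * u1 z - y * v1 z) - gam c * ((x ^ 2 - y ^ 2 + V z) * u z - 2 * x * y * v z))).
{ intros z; destruct (Hp z) as [_ [H2 H3]].
  replace (_ - _) with (Re (p2 z)); [now apply is_derive_Re|].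
  apply (f_equal Re) in H3; simpl in H3; unfold u, v, u1, v1, Re, Im in *; lra. }
assert (Hv1 : forall z, is_derive v1 z
  (2 * c * gam c * (x * v1 z + y * u1 z) - gam c * ((x ^ 2 - y ^ 2 + V z) * v z + 2 * x * y * u z))).
{ intros z; destruct (Hp z) as [_ [H2 H3]].
  replace (_ - _) with (Im (p2 z)); [now apply is_derive_Im|].
  apply (f_equal Im) in H3; simpl in H3; unfold u, v, u1, v1, Re, Im in *; lra. }
assert (HF : forall z, is_derive F z (x * e z)).
{ intros z; unfold F, s, t; auto_derive.
  - repeat split; eexists; eauto.
  - derive_subst (Hu z); derive_subst (Hv z); derive_subst (Hu1 z); derive_subst (Hv1 z).
    derive_subst (Hr z).
    unfold e, s, t, gam, n, kap; field; lra. }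
(* Cauchy-Schwarz for the cross term [A]: the defect [n * P * Q - A ^ 2] is the square of the
   imaginary part of the product whose real part is [A]. The rest of the slack is a nonnegative
   multiple of [1 - c ^ 2]. *)
assert (HFe : forall z, F z ^ 2 <= (u z ^ 2 + v z ^ 2) * (2 * n * e z)).
{ intros z.
  pose (P := u z ^ 2 + v z ^ 2). pose (Q := s z ^ 2 + t z ^ 2).
  pose (A := x * (s z * u z + t z * v z) + y * (t z * u z - s z * v z)).
  assert (HA : A ^ 2 <= n * P * Q).
  { assert (n * P * Q - A ^ 2 = (x * (t z * u z - s z * v z) - y * (s z * u z + t z * v z)) ^ 2)
      by (unfold n, P, Q, A; ring).
    assert (0 <= (x * (t z * u z - s z * v z) - y * (s z * u z + t z * v z)) ^ 2) by apply pow2_ge_0.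
    lra. }
  change ((c * n * P + kap * A) ^ 2 <= P * (2 * n * (n * P + kap * Q))).
  assert (HP : 0 <= P) by (unfold P; nra). assert (HQ : 0 <= Q) by (unfold Q; nra).
  assert ((c * n * P + kap * A) ^ 2 <= 2 * (c * n * P) ^ 2 + 2 * kap ^ 2 * A ^ 2)
    by (assert (0 <= (c * n * P - kap * A) ^ 2) by apply pow2_ge_0; lra).
  assert (2 * kap ^ 2 * A ^ 2 <= 2 * kap ^ 2 * (n * P * Q))
    by (apply Rmult_le_compat_l; [nra | easy]).
  assert (0 <= (1 - c ^ 2) * (2 * n ^ 2 * P ^ 2 + 2 * c ^ 2 * n * P * Q)).
  { apply Rmult_le_pos; [lra|].
    assert (0 <= n * P * Q) by (repeat apply Rmult_le_pos; lra).
    assert (0 <= c ^ 2) by apply pow2_ge_0.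
    nra. }
  unfold kap in *; lra. }
assert (He : forall z, 0 <= e z) by (intros z; unfold e; nra).
assert (HM' : forall z, u z ^ 2 + v z ^ 2 <= M ^ 2 + 1).
{ intros z; specialize (HM z).
  assert (H0 := Cmod_ge_0 (p z)).
  assert (H1 : Cmod (p z) ^ 2 = u z ^ 2 + v z ^ 2).
  { unfold Cmod; rewrite pow2_sqrt; [easy | nra]. }
  nra. }
(* [M ^ 2 + 1] in place of [M ^ 2] keeps the divisor positive for every [M]. *)
pose (k := x / ((M ^ 2 + 1) * (2 * n))).
assert (HM1 : 0 < (M ^ 2 + 1) * (2 * n)) by (apply Rmult_lt_0_compat; [nra | lra]).
assert (HF0 : forall z, F z = 0).
{ apply (riccati_zero F (fun z => x * e z) k).
  - apply Rdiv_lt_0_compat; lra.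
  - exact HF.
  - intros z.
    assert (F z ^ 2 <= (M ^ 2 + 1) * (2 * n) * e z).
    { apply Rle_trans with (1 := HFe z); rewrite (Rmult_assoc (M ^ 2 + 1)).
      apply Rmult_le_compat_r; [repeat apply Rmult_le_pos; auto; lra | apply HM']. }
    replace (x * e z) with (k * ((M ^ 2 + 1) * (2 * n) * e z)) by (unfold k; field; split; nra).
    apply Rmult_le_compat_l; [|easy].
    apply Rlt_le, Rdiv_lt_0_compat; lra. }
intros z.
(* An identically vanishing flux has zero derivative, so the density [e] vanishes, and its first
   summand controls [p]. *)
assert (Hez : x * e z = 0).
{ rewrite <- (is_derive_unique _ _ _ (HF z)), (Derive_ext F (fun _ => 0)); [|exact HF0].
  apply Derive_const. }
assert (e z = 0) by (apply Rmult_integral in Hez; lra).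
assert (0 <= kap * (s z ^ 2 + t z ^ 2)) by nra.
assert (Huv : n * (u z ^ 2 + v z ^ 2) <= 0) by (unfold e in *; lra).
assert (u z ^ 2 + v z ^ 2 <= 0) by nra.
apply injective_projections; [change (u z = 0) | change (v z = 0)]; nra.
Qed.

(** At a zero of [f'] the energy identity would read [1 - cos f = E < 0]. Hence [r = f'' / f'] is
    defined on the whole line and solves the Riccati equation of the linearization along [f]. *)
Lemma subluminal_rotational_stable (c : R) (f : R -> R) (E : R) :
  traveling_wave c f -> has_energy c f E -> c ^ 2 < 1 -> E < 0 -> spectrally_stable c f.
Proof.
intros Hf HE Hc HE0 lam (p & p1 & p2 & Hp & [M HM] & [z Hz]).
destruct (Rle_lt_dec (Re lam) 0) as [|Hlam]; [easy|exfalso; apply Hz].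
assert (Hf' := traveling_wave_derive c f ltac:(lra) Hf).
assert (Hphi : forall z, Derive f z <> 0).
{ intros t H; specialize (HE t); rewrite H in HE.
  assert (Hcos := COS_bound (f t)); lra. }
apply (bounded_solution_trivial c (fun t => cos (f t))
  (fun t => (- gam c * sin (f t)) / Derive f t) lam p p1 p2 M); auto.
intros t; destruct (Hf' t) as [H1 H2]; auto_derive.
- repeat split; [eexists; apply H1 | eexists; apply H2 | apply Hphi].
- derive_subst H2; change (Derive (fun x : R => f x) t) with (Derive f t); field; apply Hphi.
Qed.

(** * Hermite's solution of (P) *)

Lemma is_derive_Cmult (f g : R -> C) (z : R) (df dg : C) :
  is_derive f z df -> is_derive g z dg ->
  is_derive (fun t => f t * g t)%C z (df * g z + f z * dg)%C.
Proof.
intros Hf Hg; apply is_derive_C in Hf, Hg.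
pose (f1 t := Re (f t)). pose (f2 t := Im (f t)). pose (g1 t := Re (g t)). pose (g2 t := Im (g t)).
change (is_derive f1 z (Re df) /\ is_derive f2 z (Im df)) in Hf.
change (is_derive g1 z (Re dg) /\ is_derive g2 z (Im dg)) in Hg.
destruct Hf as [Hf1 Hf2], Hg as [Hg1 Hg2].
apply is_derive_C; split.
- apply (is_derive_ext (fun t => f1 t * g1 t - f2 t * g2 t)); [easy|].
  auto_derive; [repeat split; eexists; eassumption|].
  derive_subst Hf1; derive_subst Hf2; derive_subst Hg1; derive_subst Hg2.
  unfold f1, f2, g1, g2; simpl; unfold Re, Im; ring.
- apply (is_derive_ext (fun t => f1 t * g2 t + f2 t * g1 t)); [easy|].
  auto_derive; [repeat split; eexists; eassumption|].
  derive_subst Hf1; derive_subst Hf2; derive_subst Hg1; derive_subst Hg2.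
  unfold f1, f2, g1, g2; simpl; unfold Re, Im; ring.
Qed.

Lemma Cnorm2_pos (x : C) : x <> 0%C -> 0 < Re x ^ 2 + Im x ^ 2.
Proof.
destruct x as [a b]; intros H; simpl.
destruct (Req_dec a 0) as [Ha|Ha]; [|nra].
destruct (Req_dec b 0) as [Hb|Hb]; [|nra].
exfalso; apply H; now rewrite Ha, Hb.
Qed.

Lemma is_derive_Cinv (f : R -> C) (z : R) (df : C) :
  is_derive f z df -> f z <> 0%C ->
  is_derive (fun t => / f t)%C z (- df / (f z * f z))%C.
Proof.
intros Hf Hz; apply Cnorm2_pos in Hz as Hn.
apply is_derive_C in Hf.
pose (f1 t := Re (f t)). pose (f2 t := Im (f t)).
change (is_derive f1 z (Re df) /\ is_derive f2 z (Im df)) in Hf.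
change (0 < f1 z ^ 2 + f2 z ^ 2) in Hn.
destruct Hf as [Hf1 Hf2].
replace (- df / (f z * f z))%C with (- df * / f z * / f z)%C by (field; easy).
apply is_derive_C; split.
- apply (is_derive_ext (fun t => f1 t / (f1 t ^ 2 + f2 t ^ 2))); [easy|].
  auto_derive; [repeat split; try (eexists; eassumption); lra|].
  derive_subst Hf1; derive_subst Hf2.
  unfold f1, f2 in *; destruct (f z), df; simpl in *; field; lra.
- apply (is_derive_ext (fun t => - f2 t / (f1 t ^ 2 + f2 t ^ 2))); [easy|].
  auto_derive; [repeat split; try (eexists; eassumption); lra|].
  derive_subst Hf1; derive_subst Hf2.
  unfold f1, f2 in *; destruct (f z), df; simpl in *; field; lra.
Qed.

Lemma is_derive_RtoC (f : R -> R) (z df : R) :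
  is_derive f z df -> is_derive (fun t => RtoC (f t)) z (RtoC df).
Proof.
intros H; apply is_derive_C; simpl; split; [easy | apply (is_derive_const (V := R_NormedModule))].
Qed.

Lemma is_derive_Cexp (U V : R -> R) (z : R) (l : C) :
  is_derive U z (Re l) -> is_derive V z (Im l) ->
  is_derive (fun t => (exp (U t) * cos (V t), exp (U t) * sin (V t)) : C) z
    (l * ((exp (U z) * cos (V z))%R, (exp (U z) * sin (V z))%R))%C.
Proof.
intros HU HV; apply is_derive_C; simpl; split;
(auto_derive; [repeat split; eexists; eassumption|]);
derive_subst HU; derive_subst HV; unfold Re, Im; ring.
Qed.

Lemma is_derive_RInt_0 (h : R -> R) :
  (forall z, continuous h z) -> forall z, is_derive (RInt h 0) z (h z).
Proof.
intros Hh z; apply (is_derive_RInt h _ 0); [|easy].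
apply filter_forall; intros t.
apply (RInt_correct (V := R_CompleteNormedModule)).
apply (ex_RInt_continuous (V := R_CompleteNormedModule)); auto.
Qed.

(* With [X' = x1], [X'' = x2] and [M = (X' + W) / (2 X)], this is [M' + M^2 = - Q]. *)
Lemma riccati_product (x1 x2 W X Q : C) :
  X <> 0%C ->
  (W * W = x1 * x1 - 2 * X * x2 - 4 * Q * (X * X))%C ->
  (/ 2 * (x2 * / X + (x1 + W) * (- x1 / (X * X)))
   + (/ 2 * ((x1 + W) * / X)) * (/ 2 * ((x1 + W) * / X)) = - Q)%C.
Proof.
intros HX HW.
assert (H2 : RtoC 2 = (1 + 1)%C) by (apply injective_projections; simpl; ring).
assert (H4 : RtoC 4 = ((1 + 1) * (1 + 1))%C) by (apply injective_projections; simpl; ring).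
assert (Hn : (1 + 1)%C <> 0%C).
{ intros H; apply (f_equal Re) in H; simpl in H; lra. }
rewrite H2, H4 in *.
replace (- Q)%C with ((W * W - (x1 * x1 - (1 + 1) * X * x2)) / ((1 + 1) * (1 + 1) * (X * X)))%C.
- field; auto.
- rewrite HW; field; auto.
Qed.

(* The one-gap identity [W^2 = X'^2 - 2 X X'' - 4 Q X^2] behind Hermite's solution. *)
Lemma hermite_identity (g e y : R) (l : C) :
  let b := (RtoC e + RtoC (2 * g) * l)%C in
  let x2 := RtoC (- (y * (2 * g * (e + y))) + g * (1 - y ^ 2)) in
  let X := (RtoC y + b)%C in
  (RtoC (4 * g ^ 2) * l * (b * b - 1)
   = RtoC ((1 - y ^ 2) * (2 * g * (e + y))) - 2 * X * x2
     - 4 * (RtoC (g * y) - RtoC (g ^ 2) * l) * (X * X))%C.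
Proof.
destruct l as [l1 l2]; apply injective_projections; simpl; ring.
Qed.

(* [X] is the product of two Floquet solutions and [W] their Wronskian; the modulus of the
   solution is [sqrt |X| exp S] up to a constant. *)
Lemma in_spectrum_of_exponent (c : R) (f : R -> R) (E : R) (lam b W : C) (S : R -> R) (M : R) :
  c ^ 2 <> 1 -> traveling_wave c f -> has_energy c f E ->
  b = (RtoC (E - 1) + RtoC (2 * gam c) * (lam * lam))%C ->
  (W * W)%C = (RtoC (4 * gam c ^ 2) * (lam * lam) * (b * b - 1))%C ->
  (forall z, 0 < (cos (f z) + Re b) ^ 2 + Im b ^ 2) ->
  (forall z, is_derive S z (c * gam c * Re lam +
     (Re W * (cos (f z) + Re b) + Im W * Im b) / (2 * ((cos (f z) + Re b) ^ 2 + Im b ^ 2)))) ->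
  (forall z, S z <= M) ->
  in_spectrum c f lam.
Proof.
intros Hc Hf HE Hb HW HX HS HM.
assert (Hf' := traveling_wave_derive c f Hc Hf).
set (g := gam c) in *.
assert (Hgc : g * (c ^ 2 - 1) = 1) by (unfold g, gam; field; lra).
pose (f1 := Derive f). fold f1 in Hf'.
assert (Hf1 : forall z, f1 z ^ 2 = 2 * g * (E - 1 + cos (f z))).
{ intros z; specialize (HE z); fold f1 in HE.
  replace (f1 z ^ 2) with (g * (c ^ 2 - 1) * f1 z ^ 2) by (rewrite Hgc; ring).
  rewrite <- HE; field. }
pose (X z := (RtoC (cos (f z)) + b)%C).
pose (x1 z := - (sin (f z) * f1 z)).
pose (x2 z := - (cos (f z) * f1 z ^ 2) + g * sin (f z) ^ 2).
assert (Hx1 : forall z, is_derive (fun t => cos (f t)) z (x1 z)).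
{ intros z; destruct (Hf' z) as [H1 H2]; auto_derive; [eexists; apply H1|].
  derive_subst H1; unfold x1; ring. }
assert (Hx2 : forall z, is_derive x1 z (x2 z)).
{ intros z; destruct (Hf' z) as [H1 H2]; unfold x1; auto_derive.
  - repeat split; eexists; [apply H1 | apply H2].
  - derive_subst H1; derive_subst H2; unfold x2; ring. }
assert (HX0 : forall z, X z <> 0%C).
{ intros z H; specialize (HX z); unfold X in H.
  assert (H1 := f_equal Re H); assert (H2 := f_equal Im H); simpl in H1, H2.
  unfold Re, Im in *; rewrite H1 in HX; nra. }
assert (HXd : forall z, is_derive X z (RtoC (x1 z))).
{ intros z; unfold X.
  replace (RtoC (x1 z)) with (RtoC (x1 z) + 0)%C by ring.
  apply (is_derive_plus (V := C_R_NormedModule) (fun t => RtoC (cos (f t))) (fun _ => b)).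
  - now apply is_derive_RtoC.
  - apply (is_derive_const (V := C_R_NormedModule)). }
(* Logarithmic derivative of the solution: the constant part removes the first-order term of (P),
   the rest belongs to a solution of the resulting Hill equation. *)
pose (L z := (RtoC (c * g) * lam + / 2 * ((RtoC (x1 z) + W) * / X z))%C).
pose (dL z := (/ 2 * (RtoC (x2 z) * / X z + (RtoC (x1 z) + W) * (- RtoC (x1 z) / (X z * X z))))%C).
assert (HL : forall z, is_derive L z (dL z)).
{ intros z; unfold L, dL.
  replace (/ 2 * (RtoC (x2 z) * / X z + (RtoC (x1 z) + W) * (- RtoC (x1 z) / (X z * X z))))%C
    with (0 + (0 * ((RtoC (x1 z) + W) * / X z)
      + / 2 * (RtoC (x2 z) * / X z + (RtoC (x1 z) + W) * (- RtoC (x1 z) / (X z * X z)))))%C by ring.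
  apply (is_derive_plus (V := C_R_NormedModule) (fun _ => (RtoC (c * g) * lam)%C)).
  { apply (is_derive_const (V := C_R_NormedModule)). }
  apply (is_derive_Cmult (fun _ => (/ 2)%C)).
  { apply (is_derive_const (V := C_R_NormedModule)). }
  apply (is_derive_Cmult (fun t => (RtoC (x1 t) + W)%C)).
  - replace (RtoC (x2 z)) with (RtoC (x2 z) + 0)%C by ring.
    apply (is_derive_plus (V := C_R_NormedModule) (fun t => RtoC (x1 t)) (fun _ => W)).
    + now apply is_derive_RtoC.
    + apply (is_derive_const (V := C_R_NormedModule)).
  - now apply is_derive_Cinv. }
assert (Hric : forall z, (dL z + L z * L z - RtoC (2 * c * g) * lam * L z
   + RtoC g * (lam * lam + RtoC (cos (f z))) = 0)%C).
{ intros z.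
  assert (Hs : sin (f z) ^ 2 = 1 - cos (f z) ^ 2).
  { assert (H := sin2_cos2 (f z)); unfold Rsqr in H; simpl; lra. }
  assert (HM2 := riccati_product (RtoC (x1 z)) (RtoC (x2 z)) W (X z)
    (RtoC (g * cos (f z)) - RtoC (g ^ 2) * (lam * lam))%C (HX0 z)).
  (* Completing the square in (P) leaves [g - c^2 g^2] as the coefficient of [lam^2]; by the choice
     of [g] it is [- g^2], which gives the Hill potential [g cos f - g^2 lam^2]. *)
  assert (Hcg : (RtoC g - RtoC (c * g) * RtoC (c * g) = - RtoC (g ^ 2))%C).
  { rewrite <- RtoC_mult, <- RtoC_minus, <- RtoC_opp; f_equal.
    replace (g - c * g * (c * g)) with (g - g * (g * (c ^ 2 - 1)) - g ^ 2) by ring.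
    rewrite Hgc; ring. }
  assert (Hex : forall d m k g' y : C,
    (d + m * m = - (g' * y - RtoC (g ^ 2) * (lam * lam)))%C -> (g' - k * k = - RtoC (g ^ 2))%C ->
    (d + (k * lam + m) * (k * lam + m) - (k + k) * lam * (k * lam + m)
     + g' * (lam * lam + y) = 0)%C).
  { intros d m k g' y H1 H2.
    transitivity ((d + m * m) + ((g' - k * k) * (lam * lam) + g' * y))%C; [ring|].
    rewrite H1, H2; ring. }
  replace (RtoC (2 * c * g)) with (RtoC (c * g) + RtoC (c * g))%C
    by (rewrite <- RtoC_plus; f_equal; ring).
  unfold L; apply (Hex _ _ _ (RtoC g) (RtoC (cos (f z)))); [|exact Hcg].
  rewrite <- RtoC_mult; apply HM2; clear HM2 Hex Hcg.
  rewrite HW; unfold X; rewrite Hb at 1 2.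
  assert (HI := hermite_identity g (E - 1) (cos (f z)) (lam * lam)); cbv zeta in HI.
  rewrite HI, <- Hb; unfold x1, x2; rewrite Hs, Hf1.
  f_equal; f_equal; rewrite <- RtoC_mult; f_equal.
  replace (- (sin (f z) * f1 z) * - (sin (f z) * f1 z)) with (sin (f z) ^ 2 * f1 z ^ 2) by ring.
  now rewrite Hs, Hf1. }
assert (Hode : forall d l q k v : C, (d + l * l - k * lam * l + v = 0)%C ->
  (d * q + l * (l * q) - k * lam * (l * q) + v * q = 0)%C).
{ intros d l q k v H.
  transitivity ((d + l * l - k * lam * l + v) * q)%C; [ring | rewrite H; ring]. }
pose (V := RInt (fun t => Im (L t)) 0).
assert (HV : forall z, is_derive V z (Im (L z))).
{ apply is_derive_RInt_0; intros z.
  apply (ex_derive_continuous (V := R_NormedModule)); eexists; apply is_derive_Im, HL. }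
(* [N] is [|X|^2], so the real part of [X' / (2 X)] is the derivative of [ln N / 4]; the real part
   of [L - X' / (2 X)] is the derivative of [S]. *)
pose (N z := (cos (f z) + Re b) ^ 2 + Im b ^ 2).
pose (U z := / 4 * ln (N z) + S z).
assert (HU : forall z, is_derive U z (Re (L z))).
{ intros z; assert (H := HX z); unfold U, N; auto_derive.
  - split; [eexists; exact (proj1 (Hf' z)) | split; [simpl in *; lra | split; [eexists; exact (HS z) | exact I]]].
  - derive_subst (HS z); derive_subst (proj1 (Hf' z)).
    unfold L, X, x1; destruct b as [br bi], lam as [lr li], W as [wr wi].
    unfold Re, Im in *; simpl in *; field; lra. }
pose (p z := (exp (U z) * cos (V z), exp (U z) * sin (V z)) : C).
assert (Hp : forall z, is_derive p z (L z * p z)%C) by (intros z; now apply is_derive_Cexp).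
exists p, (fun z => L z * p z)%C, (fun z => dL z * p z + L z * (L z * p z))%C.
split; [|split].
- intros z; split; [apply Hp | split].
  + apply is_derive_Cmult; auto.
  + exact (Hode _ _ _ _ _ (Hric z)).
- assert (HN : forall z, N z <= (1 + Rabs (Re b)) ^ 2 + Im b ^ 2).
  { intros z; unfold N; assert (H := COS_bound (f z)).
    apply Rplus_le_compat_r; rewrite <- (pow2_abs (cos (f z) + Re b)); apply pow_incr.
    split; [apply Rabs_pos|]; apply Rle_trans with (1 := Rabs_triang _ _).
    apply Rplus_le_compat_r, Rabs_le; lra. }
  assert (Hpn : forall z, Cmod (p z) = exp (U z)).
  { intros z; unfold Cmod, p; simpl.
    rewrite <- (sqrt_pow2 (exp (U z))) at 5 by (apply Rlt_le, exp_pos).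
    f_equal; assert (H := sin2_cos2 (V z)); unfold Rsqr in H.
    transitivity (exp (U z) ^ 2 * (sin (V z) * sin (V z) + cos (V z) * cos (V z))); [ring|].
    rewrite H; ring. }
  exists (exp (/ 4 * ln ((1 + Rabs (Re b)) ^ 2 + Im b ^ 2) + M)); intros z.
  rewrite Hpn; apply Rnot_lt_le; intros Hlt; apply exp_lt_inv in Hlt; unfold U in Hlt.
  assert (ln (N z) <= ln ((1 + Rabs (Re b)) ^ 2 + Im b ^ 2)) by (apply ln_le; auto; apply HX).
  specialize (HM z); lra.
- exists 0; intros H.
  assert (H1 := f_equal Re H); assert (H2 := f_equal Im H); unfold p in H1, H2; simpl in H1, H2.
  assert (He := exp_pos (U 0)); assert (Hsc := sin2_cos2 (V 0)); unfold Rsqr in Hsc.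
  apply Rmult_integral in H1, H2; nra.
Qed.

(** * Bounded exponents *)

Lemma continuous_ex_derive (h : R -> R) (x : R) : ex_derive h x -> continuous h x.
Proof. apply (ex_derive_continuous (V := R_NormedModule)). Qed.

Lemma ex_RInt_cont (h : R -> R) (x y : R) : (forall z, continuous h z) -> ex_RInt h x y.
Proof. intros H; apply (ex_RInt_continuous (V := R_CompleteNormedModule)); auto. Qed.

Lemma periodic_IZR (F : R -> R) (T : R) :
  (forall x, F (x + T) = F x) -> forall (n : Z) x, F (x + IZR n * T) = F x.
Proof.
intros HF.
assert (Hnat : forall (n : nat) x, F (x + INR n * T) = F x).
{ induction n as [|n IH]; intros x; [simpl; f_equal; ring|].
  rewrite S_INR; replace (x + (INR n + 1) * T) with (x + INR n * T + T) by ring.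
  now rewrite HF. }
intros n x; destruct (Z.le_gt_cases 0 n) as [Hn|Hn].
- rewrite <- (Z2Nat.id n), <- INR_IZR_INZ by easy; apply Hnat.
- rewrite <- (Hnat (Z.to_nat (- n))), INR_IZR_INZ, Z2Nat.id, opp_IZR by lia; f_equal; ring.
Qed.

Lemma periodic_bounded (F : R -> R) (T : R) :
  0 < T -> (forall x, continuous F x) -> (forall x, F (x + T) = F x) ->
  exists M, forall x, F x <= M.
Proof.
intros HT HC HF.
destruct (continuity_ab_maj F 0 T) as [t [Ht _]]; [lra | |].
{ intros x _; apply continuity_pt_filterlim, HC. }
exists (F t); intros x.
destruct (base_Int_part (x / T)) as [H1 H2].
rewrite <- (periodic_IZR F T HF (- Int_part (x / T)) x), opp_IZR.
assert (Hx : x = x / T * T) by (field; lra).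
apply Ht; split; nra.
Qed.

(** In the variable [x = theta z] one has [dz = dx / g x]. A primitive [Q] of [h / g] composed with
    [theta] is therefore a primitive of [h] along the orbit, and the vanishing integral over a
    period makes [Q] periodic, hence bounded. *)
Lemma bounded_composed_primitive (theta g h : R -> R) :
  (forall z, is_derive theta z (g (theta z))) ->
  (forall x, 0 < g x) ->
  (forall x, continuous g x) -> (forall x, continuous h x) ->
  (forall x, h (x + 2 * PI) / g (x + 2 * PI) = h x / g x) ->
  RInt (fun x => h x / g x) 0 (2 * PI) = 0 ->
  exists (S : R -> R) (M : R),
    (forall z, is_derive S z (h (theta z))) /\ forall z, S z <= M.
Proof.
intros Hth Hg Hgc Hhc Hper HI.
pose (q x := h x / g x). pose (Q := RInt q 0).
assert (Hq : forall x, continuous q x).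
{ intros x; apply (continuous_mult (K := R_AbsRing)); [apply Hhc|].
  apply (continuous_comp g Rinv); [apply Hgc|].
  apply continuity_pt_filterlim, continuity_pt_inv; [apply continuity_pt_id | ].
  apply Rgt_not_eq, Hg. }
assert (HQ : forall x, is_derive Q x (q x)) by now apply is_derive_RInt_0.
assert (HQper : forall x, Q (x + 2 * PI) = Q x).
{ assert (Hd : forall x, is_derive (fun x => Q (x + 2 * PI) - Q x) x 0).
  { intros x; auto_derive; [repeat split; eexists; apply HQ|].
    derive_subst (HQ (x + 2 * PI)); derive_subst (HQ x).
    unfold q; rewrite Hper; ring. }
  assert (H0 : Q (0 + 2 * PI) - Q 0 = 0).
  { unfold Q at 2; rewrite (RInt_point (V := R_CompleteNormedModule)), Rplus_0_l.
    unfold Q, q; rewrite HI; unfold zero; simpl; ring. }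
  intros x; assert (H := derive_zero_const _ Hd x 0); simpl in H; lra. }
destruct (periodic_bounded Q (2 * PI)) as [M HM].
- assert (H := PI_RGT_0); lra.
- intros x; apply continuous_ex_derive; eexists; apply HQ.
- exact HQper.
- exists (fun z => Q (theta z)), M; split; [|auto].
  intros z; replace (h (theta z)) with (g (theta z) * q (theta z))
    by (unfold q; field; apply Rgt_not_eq, Hg).
  apply (is_derive_comp Q theta); auto.
Qed.

(** A Lipschitz bound in the parameter that is uniform in the integration variable passes to the
    integral. *)
Lemma continuity_pt_param_RInt (h : R -> R -> R) (x y t K d : R) :
  x <= y -> 0 < d ->
  (forall s, Rabs (s - t) < d -> forall z, continuous (h s) z) ->
  (forall s z, Rabs (s - t) < d -> Rabs (h s z - h t z) <= K * Rabs (s - t)) ->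
  continuity_pt (fun s => RInt (h s) x y) t.
Proof.
intros Hxy Hd Hc HK eps Heps.
(* Both [+ 1] keep [L] positive when [K = 0] or [x = y], so that [eps / L] can serve as a radius. *)
pose (L := (Rabs K + 1) * (y - x + 1)).
assert (HL : 0 < L) by (assert (H := Rabs_pos K); unfold L; nra).
assert (HKL : 0 <= K).
{ assert (H := HK (t + d / 2) 0); replace (t + d / 2 - t) with (d / 2) in H by ring.
  rewrite (Rabs_right (d / 2)) in H by lra.
  assert (H1 := Rabs_pos (h (t + d / 2) 0 - h t 0)); specialize (H ltac:(lra)); nra. }
exists (Rmin d (eps / L)); split.
- apply Rmin_pos; [easy | apply Rdiv_lt_0_compat; lra].
- intros s [_ Hs]; simpl in *; unfold R_dist in *.
  assert (Hs1 : Rabs (s - t) < d) by (apply Rlt_le_trans with (1 := Hs), Rmin_l).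
  assert (Hs2 : Rabs (s - t) < eps / L) by (apply Rlt_le_trans with (1 := Hs), Rmin_r).
  assert (Ht1 : Rabs (t - t) < d) by (rewrite Rminus_diag, Rabs_R0; easy).
  assert (Es : ex_RInt (h s) x y) by (apply ex_RInt_cont; auto).
  assert (Et : ex_RInt (h t) x y) by (apply ex_RInt_cont; auto).
  rewrite <- (RInt_minus (V := R_CompleteNormedModule)) by easy.
  apply Rle_lt_trans with ((y - x) * (K * Rabs (s - t))).
  + apply (abs_RInt_le_const (fun z => minus (h s z) (h t z))); [easy | |].
    * now apply (ex_RInt_minus (V := R_CompleteNormedModule)).
    * intros z _; now apply HK.
  + apply Rle_lt_trans with (L * Rabs (s - t)).
    * rewrite <- Rmult_assoc; apply Rmult_le_compat_r; [apply Rabs_pos|].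
      unfold L; rewrite Rabs_right by lra; nra.
    * apply Rlt_le_trans with (L * (eps / L)); [now apply Rmult_lt_compat_l|].
      right; field; lra.
Qed.

(** * The mean exponent as a function of the spectral parameter *)

Lemma continuous_div (h q : R -> R) (x : R) :
  continuous h x -> continuous q x -> q x <> 0 -> continuous (fun t => h t / q t) x.
Proof.
intros Hh Hq H0; apply (continuous_mult (K := R_AbsRing)); [easy|].
apply (continuous_comp q Rinv); [easy|].
apply continuity_pt_filterlim, continuity_pt_inv; [apply continuity_pt_id | easy].
Qed.

Lemma continuity_pt_lorentzian_RInt (k : R -> R) (K a t : R) :
  (forall x, continuous k x) -> (forall x, Rabs (k x) <= K) -> 0 < t ->
  continuity_pt (fun s => RInt (fun x => k x / ((a * cos x) ^ 2 + s ^ 2)) 0 (2 * PI)) t.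
Proof.
intros Hk HK Ht.
assert (HPI := PI_RGT_0).
assert (Hs : forall s, Rabs (s - t) < t / 2 -> t / 2 < s < 3 / 2 * t)
  by (intros s Hs; apply Rabs_lt_between in Hs; lra).
(* For [t / 2 < s < 3 / 2 * t] the numerator [s + t] is at most [5 / 2 * t] and the product of the
   denominators at least [t ^ 4 / 4]; their ratio is [10 / t ^ 3]. *)
apply (continuity_pt_param_RInt (fun s x => k x / ((a * cos x) ^ 2 + s ^ 2))
  0 (2 * PI) t (K * (10 / t ^ 3)) (t / 2)); try lra.
- intros s H z; specialize (Hs s H).
  apply continuous_div; [apply Hk | | assert (0 <= (a * cos z) ^ 2) by apply pow2_ge_0; nra].
  apply continuous_ex_derive; auto_derive; easy.
- intros s z H; specialize (Hs s H); pose (q := (a * cos z) ^ 2); fold q.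
  assert (Hq : 0 <= q) by apply pow2_ge_0.
  assert (Hs2 : 0 < q + s ^ 2) by nra. assert (Ht2 : 0 < q + t ^ 2) by nra.
  replace (k z / (q + s ^ 2) - k z / (q + t ^ 2))
    with (k z * (- (s + t) / ((q + s ^ 2) * (q + t ^ 2)) * (s - t))) by (field; lra).
  rewrite !Rabs_mult, Rmult_assoc.
  apply Rmult_le_compat; [apply Rabs_pos | | apply HK |].
  { apply Rmult_le_pos; apply Rabs_pos. }
  apply Rmult_le_compat_r; [apply Rabs_pos|].
  replace (- (s + t) / ((q + s ^ 2) * (q + t ^ 2)))
    with (- ((s + t) / ((q + s ^ 2) * (q + t ^ 2)))) by (field; lra).
  assert (Hden : 0 < (q + s ^ 2) * (q + t ^ 2)) by (apply Rmult_lt_0_compat; lra).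
  rewrite Rabs_Ropp, Rabs_right
    by (apply Rle_ge, Rlt_le, Rdiv_lt_0_compat; lra).
  apply Rle_div_l; [lra|].
  assert (Ht3 : 0 < t ^ 3) by (apply pow_lt; lra).
  replace (10 / t ^ 3 * ((q + s ^ 2) * (q + t ^ 2)))
    with (((q + s ^ 2) * (q + t ^ 2)) * 10 / t ^ 3) by (field; lra).
  apply Rle_div_r; [easy|].
  assert (t ^ 2 / 4 * t ^ 2 <= (q + s ^ 2) * (q + t ^ 2)).
  { apply Rmult_le_compat; nra. }
  assert ((s + t) * t ^ 3 <= 5 / 2 * t * t ^ 3) by (apply Rmult_le_compat_r; lra).
  simpl in *; lra.
Qed.

(* [sqrt_re mu tau + i sqrt_im mu tau] is the principal square root of [- mu + i tau]. *)
Definition sqrt_re (mu tau : R) : R := sqrt ((sqrt (mu ^ 2 + tau ^ 2) - mu) / 2).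
Definition sqrt_im (mu tau : R) : R := sqrt ((sqrt (mu ^ 2 + tau ^ 2) + mu) / 2).

(** The lower bounds keep the radicands of [sqrt_re] and [sqrt_im] positive; the upper bound gives
    [sqrt_re mu tau ^ 2 < tau / 2], hence decay as [tau] tends to 0. *)
Lemma modulus_gt (mu tau : R) : 0 < mu -> 0 < tau ->
  mu < sqrt (mu ^ 2 + tau ^ 2) /\ tau < sqrt (mu ^ 2 + tau ^ 2) < mu + tau.
Proof.
intros Hm Ht; split; [|split].
- rewrite <- (sqrt_pow2 mu) at 1 by lra; apply sqrt_lt_1_alt; nra.
- rewrite <- (sqrt_pow2 tau) at 1 by lra; apply sqrt_lt_1_alt; nra.
- rewrite <- (sqrt_pow2 (mu + tau)) by lra; apply sqrt_lt_1_alt; nra.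
Qed.

Lemma sqrt_re_pow2 (mu tau : R) : 0 < mu -> 0 < tau ->
  sqrt_re mu tau ^ 2 = (sqrt (mu ^ 2 + tau ^ 2) - mu) / 2.
Proof. intros Hm Ht; unfold sqrt_re; rewrite pow2_sqrt; [easy|]. destruct (modulus_gt mu tau); lra. Qed.

Lemma sqrt_im_pow2 (mu tau : R) : 0 < mu -> 0 < tau ->
  sqrt_im mu tau ^ 2 = (sqrt (mu ^ 2 + tau ^ 2) + mu) / 2.
Proof. intros Hm Ht; unfold sqrt_im; rewrite pow2_sqrt; [easy|]. destruct (modulus_gt mu tau); lra. Qed.

Lemma sqrt_re_pos (mu tau : R) : 0 < mu -> 0 < tau -> 0 < sqrt_re mu tau.
Proof. intros Hm Ht; apply sqrt_lt_R0; destruct (modulus_gt mu tau); lra. Qed.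

Lemma sqrt_im_pos (mu tau : R) : 0 < mu -> 0 < tau -> 0 < sqrt_im mu tau.
Proof. intros Hm Ht; apply sqrt_lt_R0; destruct (modulus_gt mu tau); lra. Qed.

Lemma sqrt_re_im (mu tau : R) : 0 < mu -> 0 < tau -> 2 * sqrt_re mu tau * sqrt_im mu tau = tau.
Proof.
intros Hm Ht; destruct (modulus_gt mu tau) as [H1 H2]; auto.
unfold sqrt_re, sqrt_im; rewrite Rmult_assoc, <- sqrt_mult by lra.
replace ((sqrt (mu ^ 2 + tau ^ 2) - mu) / 2 * ((sqrt (mu ^ 2 + tau ^ 2) + mu) / 2))
  with ((sqrt (mu ^ 2 + tau ^ 2) ^ 2 - mu ^ 2) / 4) by field.
rewrite pow2_sqrt by nra.
replace ((mu ^ 2 + tau ^ 2 - mu ^ 2) / 4) with ((tau / 2) ^ 2) by field.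
rewrite sqrt_pow2; lra.
Qed.

(** The modulus grows in [mu] with slope at most 1, by the difference of squares. *)
Lemma sqrt_re_decr (mu m tau : R) : 0 < mu -> mu <= m -> 0 < tau -> sqrt_re m tau <= sqrt_re mu tau.
Proof.
intros Hmu Hm Ht; apply sqrt_le_1_alt.
assert (H1 := modulus_gt mu tau Hmu Ht); assert (H2 := modulus_gt m tau ltac:(lra) Ht).
assert (Q1 : sqrt (mu ^ 2 + tau ^ 2) ^ 2 = mu ^ 2 + tau ^ 2) by (apply pow2_sqrt; nra).
assert (Q2 : sqrt (m ^ 2 + tau ^ 2) ^ 2 = m ^ 2 + tau ^ 2) by (apply pow2_sqrt; nra).
assert (sqrt (m ^ 2 + tau ^ 2) - sqrt (mu ^ 2 + tau ^ 2) <= m - mu); [|lra].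
assert ((sqrt (m ^ 2 + tau ^ 2) - sqrt (mu ^ 2 + tau ^ 2)) * (sqrt (m ^ 2 + tau ^ 2) + sqrt (mu ^ 2 + tau ^ 2)) = (m - mu) * (m + mu)) by lra.
apply Rnot_lt_le; intros Hlt; nra.
Qed.

Lemma continuity_pt_ex_derive (h : R -> R) (x : R) : ex_derive h x -> continuity_pt h x.
Proof. intros H; now apply continuity_pt_filterlim, continuous_ex_derive. Qed.

Lemma ex_derive_sqrt_re (mu tau : R) : 0 < mu -> 0 < tau -> ex_derive (sqrt_re mu) tau.
Proof.
intros Hm Ht; destruct (modulus_gt mu tau) as [H1 H2]; auto.
unfold sqrt_re; auto_derive; split; [nra | split; [unfold Rdiv in *; simpl in *; lra | easy]].
Qed.

Lemma ex_derive_sqrt_im (mu tau : R) : 0 < mu -> 0 < tau -> ex_derive (sqrt_im mu) tau.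
Proof.
intros Hm Ht; destruct (modulus_gt mu tau) as [H1 H2]; auto.
unfold sqrt_im; auto_derive; split; [nra | split; [unfold Rdiv in *; simpl in *; lra | easy]].
Qed.

(** Intermediate values for [J]. For small [tau] the term with [sqrt_re mu tau] is negligible
    against the lower bound [delta] for [D]. For large [tau] the bounds [tau^2 B <= N] and
    [tau^2 D <= a N] reduce the matter to [C] against a ratio that tends to 1. *)
Lemma superluminal_root (w : R -> R) (C a m mu delta K : R) :
  (forall x, continuous w x) -> (forall x, 0 < w x <= K) ->
  1 < C -> 0 < a -> 0 < mu <= m -> 0 < delta ->
  (forall tau, 0 < tau <= 1 ->
     delta <= RInt (fun x => - (a * cos x * w x) / ((a * cos x) ^ 2 + tau ^ 2)) 0 (2 * PI)) ->
  exists tau, 0 < tau /\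
    RInt (fun x => C * sqrt_re mu tau * w x - sqrt (a ^ 2 + tau ^ 2) *
      ((sqrt_re m tau * tau - sqrt_im m tau * (a * cos x)) / ((a * cos x) ^ 2 + tau ^ 2) * w x))
      0 (2 * PI) = 0.
Proof.
intros Hwc Hw HC Ha Hmu Hdelta HD.
assert (HPI := PI_RGT_0).
pose (N := RInt w 0 (2 * PI)).
pose (B tau := RInt (fun x => w x / ((a * cos x) ^ 2 + tau ^ 2)) 0 (2 * PI)).
pose (D tau := RInt (fun x => - (a * cos x * w x) / ((a * cos x) ^ 2 + tau ^ 2)) 0 (2 * PI)).
pose (J tau := C * N * sqrt_re mu tau
  - sqrt (a ^ 2 + tau ^ 2) * (sqrt_re m tau * tau * B tau + sqrt_im m tau * D tau)).
assert (Hkc : forall x, continuous (fun x => - (a * cos x * w x)) x).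
{ intros x; apply (continuous_opp (V := R_NormedModule)), (continuous_mult (K := R_AbsRing)); [|auto].
  apply continuous_ex_derive; auto_derive; easy. }
assert (Hden : forall tau x, 0 < tau -> tau ^ 2 <= (a * cos x) ^ 2 + tau ^ 2)
  by (intros tau x Ht; assert (H := pow2_ge_0 (a * cos x)); lra).
assert (Hden0 : forall tau x, 0 < tau -> 0 < (a * cos x) ^ 2 + tau ^ 2)
  by (intros tau x Ht; specialize (Hden tau x Ht); nra).
assert (HdC : forall tau x, continuous (fun x => (a * cos x) ^ 2 + tau ^ 2) x)
  by (intros; apply continuous_ex_derive; auto_derive; easy).
assert (EN : ex_RInt w 0 (2 * PI)) by now apply ex_RInt_cont.
assert (EB : forall tau, 0 < tau -> ex_RInt (fun x => w x / ((a * cos x) ^ 2 + tau ^ 2)) 0 (2 * PI)).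
{ intros tau Ht; apply ex_RInt_cont; intros x; apply continuous_div; auto.
  apply Rgt_not_eq, Hden0, Ht. }
assert (ED : forall tau, 0 < tau ->
  ex_RInt (fun x => - (a * cos x * w x) / ((a * cos x) ^ 2 + tau ^ 2)) 0 (2 * PI)).
{ intros tau Ht; apply ex_RInt_cont; intros x.
  apply (continuous_div (fun x => - (a * cos x * w x))); auto.
  apply Rgt_not_eq, Hden0, Ht. }
assert (HJ : forall tau, 0 < tau ->
  RInt (fun x => C * sqrt_re mu tau * w x - sqrt (a ^ 2 + tau ^ 2) *
      ((sqrt_re m tau * tau - sqrt_im m tau * (a * cos x)) / ((a * cos x) ^ 2 + tau ^ 2) * w x))
      0 (2 * PI) = J tau).
{ intros tau Ht; apply is_RInt_unique.
  apply (is_RInt_ext (fun x => minus (scal (C * sqrt_re mu tau) (w x))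
     (scal (sqrt (a ^ 2 + tau ^ 2))
       (plus (scal (sqrt_re m tau * tau) (w x / ((a * cos x) ^ 2 + tau ^ 2)))
             (scal (sqrt_im m tau) (- (a * cos x * w x) / ((a * cos x) ^ 2 + tau ^ 2))))))).
  { intros x _; unfold minus, plus, opp, scal; simpl; unfold mult; simpl.
    field; apply Rgt_not_eq; specialize (Hden0 tau x Ht); simpl in Hden0; lra. }
  replace (J tau) with (minus (scal (C * sqrt_re mu tau) N)
     (scal (sqrt (a ^ 2 + tau ^ 2))
       (plus (scal (sqrt_re m tau * tau) (B tau)) (scal (sqrt_im m tau) (D tau))))).
  2: { unfold J, minus, plus, opp, scal; simpl; unfold mult; simpl; ring. }
  apply (is_RInt_minus (V := R_NormedModule)).
  - apply (is_RInt_scal (V := R_NormedModule)), (RInt_correct (V := R_CompleteNormedModule)), EN.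
  - apply (is_RInt_scal (V := R_NormedModule)), (is_RInt_plus (V := R_NormedModule));
    apply (is_RInt_scal (V := R_NormedModule)), (RInt_correct (V := R_CompleteNormedModule)); auto. }
assert (HN : 0 < N).
{ apply RInt_gt_0; auto; [lra | intros; apply Hw]. }
assert (Jc : forall tau, 0 < tau -> continuity_pt J tau).
{ intros tau Ht; unfold J.
  assert (CB : continuity_pt B tau).
  { apply (continuity_pt_lorentzian_RInt w K); auto.
    intros x; rewrite Rabs_right; [apply Hw | apply Rle_ge, Rlt_le, Hw]. }
  assert (CD : continuity_pt D tau).
  { apply (continuity_pt_lorentzian_RInt _ (a * K)); auto.
    intros x; rewrite Rabs_Ropp, !Rabs_mult, (Rabs_right a), (Rabs_right (w x))
      by (try apply Rle_ge, Rlt_le, Hw; lra).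
    assert (Hcos : Rabs (cos x) <= 1) by (apply Rabs_le, COS_bound).
    rewrite Rmult_assoc; apply Rmult_le_compat_l; [lra|].
    rewrite <- (Rmult_1_l K); apply Rmult_le_compat; auto; [apply Rabs_pos | apply Rlt_le, Hw | apply Hw]. }
  assert (S1 : continuity_pt (sqrt_re mu) tau)
    by (apply continuity_pt_ex_derive, ex_derive_sqrt_re; lra).
  assert (S2 : continuity_pt (sqrt_re m) tau)
    by (apply continuity_pt_ex_derive, ex_derive_sqrt_re; lra).
  assert (S3 : continuity_pt (sqrt_im m) tau)
    by (apply continuity_pt_ex_derive, ex_derive_sqrt_im; lra).
  assert (S4 : continuity_pt (fun tau => sqrt (a ^ 2 + tau ^ 2)) tau)
    by (apply continuity_pt_ex_derive; auto_derive; nra).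
  apply continuity_pt_minus; [apply continuity_pt_scal, S1|].
  apply (continuity_pt_mult (fun tau => sqrt (a ^ 2 + tau ^ 2))); [apply S4|].
  apply (continuity_pt_plus (fun tau => sqrt_re m tau * tau * B tau)).
  - apply (continuity_pt_mult (fun tau => sqrt_re m tau * tau)); [|exact CB].
    apply (continuity_pt_mult (sqrt_re m) id); [exact S2 | apply continuity_pt_id].
  - apply (continuity_pt_mult (sqrt_im m)); auto. }
assert (HB0 : forall tau, 0 < tau -> 0 <= B tau).
{ intros tau Ht; apply RInt_ge_0; [lra | auto |].
  intros x _; apply Rlt_le, Rdiv_lt_0_compat; [apply Hw | apply Hden0, Ht]. }
assert (HB1 : forall tau, 0 < tau -> tau ^ 2 * B tau <= N).
{ intros tau Ht; unfold B, N.
  rewrite <- (RInt_scal (V := R_CompleteNormedModule)) by auto.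
  apply RInt_le; [lra | | auto |].
  - apply (ex_RInt_scal (V := R_NormedModule)); auto.
  - intros x _; unfold scal; simpl; unfold mult; simpl.
    specialize (Hden tau x Ht); specialize (Hden0 tau x Ht); specialize (Hw x).
    replace (tau * (tau * 1) * (w x / (a * cos x * (a * cos x * 1) + tau * (tau * 1))))
      with (tau ^ 2 * w x / ((a * cos x) ^ 2 + tau ^ 2)) by (simpl; field; simpl in *; lra).
    apply Rle_div_l; [easy | nra]. }
assert (HD1 : forall tau, 0 < tau -> tau ^ 2 * D tau <= a * N).
{ intros tau Ht; unfold D, N.
  rewrite <- !(RInt_scal (V := R_CompleteNormedModule)) by auto.
  apply RInt_le; [lra | | | ].
  - apply (ex_RInt_scal (V := R_NormedModule)); auto.
  - apply (ex_RInt_scal (V := R_NormedModule)); auto.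
  - intros x _; unfold scal; simpl; unfold mult; simpl.
    specialize (Hden tau x Ht); specialize (Hden0 tau x Ht); specialize (Hw x).
    replace (tau * (tau * 1) * (- (a * cos x * w x) / (a * cos x * (a * cos x * 1) + tau * (tau * 1))))
      with (a * (- cos x * (tau ^ 2 * w x)) / ((a * cos x) ^ 2 + tau ^ 2)) by (simpl; field; simpl in *; lra).
    apply Rle_div_l; [easy|].
    rewrite Rmult_assoc; apply Rmult_le_compat_l; [lra|].
    assert (Hc := COS_bound x).
    assert (0 <= tau ^ 2 * w x) by (apply Rmult_le_pos; nra).
    assert (- cos x * (tau ^ 2 * w x) <= 1 * (tau ^ 2 * w x)) by (apply Rmult_le_compat_r; lra).
    nra. }
assert (Hsmall : exists t0, 0 < t0 <= 1 /\ J t0 < 0).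
(* [rho] is the size of [sqrt_re mu t0] at which its term [C * N * rho] equals the lower bound
   [a * (sqrt m * delta)] of the competing term; [t0 <= rho ^ 2] keeps [sqrt_re mu t0] below it. *)
{ pose (rho := a * delta * sqrt m / (C * N)).
  assert (Hsm : 0 < sqrt m) by (apply sqrt_lt_R0; lra).
  assert (HCN : 0 < C * N) by nra.
  assert (Hrho : 0 < rho) by (apply Rdiv_lt_0_compat; [repeat apply Rmult_lt_0_compat; lra | easy]).
  pose (t0 := Rmin 1 (rho ^ 2)).
  assert (Ht0 : 0 < t0) by (apply Rmin_pos; [lra | now apply pow_lt]).
  assert (Ht1 : t0 <= 1) by apply Rmin_l.
  assert (Ht2 : t0 <= rho ^ 2) by apply Rmin_r.
  exists t0; split; [lra|].
  assert (Hsr : sqrt_re mu t0 < rho).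
  { apply Rnot_le_lt; intros H.
    assert (H1 := sqrt_re_pow2 mu t0 (proj1 Hmu) Ht0).
    assert (H2 := modulus_gt mu t0 (proj1 Hmu) Ht0). nra. }
  assert (H1 : C * N * sqrt_re mu t0 < a * (sqrt m * delta)).
  { replace (a * (sqrt m * delta)) with (C * N * rho) by (unfold rho; field; lra).
    now apply Rmult_lt_compat_l. }
  assert (H2 : a * (sqrt m * delta) <= sqrt (a ^ 2 + t0 ^ 2) * (sqrt_re m t0 * t0 * B t0 + sqrt_im m t0 * D t0)).
  { assert (Hm0 : 0 < m) by lra.
    assert (M1 := modulus_gt a t0 Ha Ht0). assert (M2 := modulus_gt m t0 Hm0 Ht0).
    apply Rmult_le_compat; [lra | | lra |].
    - apply Rmult_le_pos; lra.
    - assert (0 <= sqrt_re m t0 * t0 * B t0).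
      { repeat apply Rmult_le_pos; auto; [|lra]. apply Rlt_le, sqrt_re_pos; lra. }
      assert (sqrt m * delta <= sqrt_im m t0 * D t0); [|lra].
      apply Rmult_le_compat; [lra | lra | apply sqrt_le_1_alt; lra | apply HD; lra]. }
  unfold J; lra. }
assert (Hlarge : exists t1, 1 < t1 /\ 0 < J t1).
(* Large enough for [r <= (C + 1) / 2], and for [(t1 - m) * (C - 1)] to exceed [a * (C + 1)], which
   is what the last comparison needs. *)
{ pose (t1 := m + 1 + a * (C + 1) / (C - 1)).
  assert (Hp : 0 < a * (C + 1) / (C - 1)) by (apply Rdiv_lt_0_compat; nra).
  assert (Ht1 : 1 < t1) by (unfold t1; lra).
  assert (Ht0 : 0 < t1) by lra. assert (Hm0 : 0 < m) by lra.
  exists t1; split; [easy|].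
  assert (Hkey : (t1 - m) * (C - 1) = (C - 1) + a * (C + 1)) by (unfold t1; field; lra).
  pose (r := sqrt (a ^ 2 + t1 ^ 2) / t1).
  assert (M1 := modulus_gt a t1 Ha Ht0). assert (M2 := modulus_gt m t1 Hm0 Ht0).
  assert (Hr0 : 0 < r) by (apply Rdiv_lt_0_compat; lra).
  assert (Hr1 : r <= (C + 1) / 2).
  { apply Rle_div_l; [easy|]. nra. }
  pose (sr := sqrt_re m t1). pose (si := sqrt_im m t1).
  assert (Hsr : 0 < sr) by now apply sqrt_re_pos.
  assert (Hsi : 0 < si) by now apply sqrt_im_pos.
  assert (Hsr2 : sr ^ 2 = (sqrt (m ^ 2 + t1 ^ 2) - m) / 2) by now apply sqrt_re_pow2.
  assert (Hsri : 2 * sr * si = t1) by now apply sqrt_re_im.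
  assert (Hsrmu : sr <= sqrt_re mu t1) by (apply sqrt_re_decr; lra).
  (* The extra factor [sr] brings in [sr ^ 2] and [2 * sr * si = t1], for which closed forms are
     available. *)
  assert (Hlow : 0 < sr * (C * sr - r * (sr + a * (si / t1)))).
  { replace (sr * (C * sr - r * (sr + a * (si / t1))))
      with (sr ^ 2 * (C - r) - r * a * (2 * sr * si) / (2 * t1)) by (field; lra).
    rewrite Hsri; replace (r * a * t1 / (2 * t1)) with (a * r / 2) by (field; lra).
    assert ((t1 - m) / 2 * ((C - 1) / 2) <= sr ^ 2 * (C - r)) by (apply Rmult_le_compat; nra).
    nra. }
  assert (Hlow' : 0 < C * sr - r * (sr + a * (si / t1))) by nra.
  assert (HBD : sqrt (a ^ 2 + t1 ^ 2) * (sr * t1 * B t1 + si * D t1) <= N * (r * (sr + a * (si / t1)))).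
  { replace (sqrt (a ^ 2 + t1 ^ 2)) with (r * t1) by (unfold r; field; lra).
    replace (r * t1 * (sr * t1 * B t1 + si * D t1))
      with (r * (sr * (t1 ^ 2 * B t1) + si / t1 * (t1 ^ 2 * D t1))) by (field; lra).
    replace (N * (r * (sr + a * (si / t1)))) with (r * (sr * N + si / t1 * (a * N))) by ring.
    assert (0 < si / t1) by (apply Rdiv_lt_0_compat; lra).
    apply Rmult_le_compat_l; [lra|].
    apply Rplus_le_compat; apply Rmult_le_compat_l; auto; lra. }
  assert (C * N * sr <= C * N * sqrt_re mu t1) by (apply Rmult_le_compat_l; nra).
  assert (0 < N * (C * sr - r * (sr + a * (si / t1)))) by now apply Rmult_lt_0_compat.
  unfold J; fold sr si; lra. }
destruct Hsmall as [t0 [Ht0 HJ0]], Hlarge as [t1 [Ht1 HJ1]].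
destruct (Ranalysis5.IVT_interv J t0 t1) as [tau [Htau Hz]]; auto.
- intros s Hs; apply Jc; lra.
- lra.
- exists tau; split; [lra|]. rewrite HJ; [easy | lra].
Qed.

(** Angular speed of the phase. With [0 < a < m] it never vanishes, so the phase of a librational
    wave also turns in one direction only. *)
Definition pspeed (k m a x : R) : R := sqrt (k * (m + a * cos x)).

Lemma pspeed_arg_pos (m a x : R) : 0 < a < m -> 0 < m - a <= m + a * cos x.
Proof. intros Ha; assert (H := COS_bound x); split; nra. Qed.

Lemma pspeed_pos (k m a x : R) : 0 < k -> 0 < a < m -> 0 < pspeed k m a x.
Proof. intros Hk Ha; apply sqrt_lt_R0; assert (H := pspeed_arg_pos m a x Ha); nra. Qed.

Lemma pspeed_ge (k m a x : R) : 0 < k -> 0 < a < m -> sqrt (k * (m - a)) <= pspeed k m a x.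
Proof. intros Hk Ha; apply sqrt_le_1_alt, Rmult_le_compat_l; [lra | now apply pspeed_arg_pos]. Qed.

Lemma pspeed_le (k m a x : R) : 0 < k -> 0 < a < m -> pspeed k m a x <= sqrt (k * (m + a)).
Proof. intros Hk Ha; apply sqrt_le_1_alt, Rmult_le_compat_l; [lra | assert (H := COS_bound x); nra]. Qed.

Lemma continuous_pspeed (k m a x : R) : 0 < k -> 0 < a < m -> continuous (pspeed k m a) x.
Proof.
intros Hk Ha; apply continuous_ex_derive; unfold pspeed; auto_derive.
assert (H := pspeed_arg_pos m a x Ha); nra.
Qed.

Lemma continuous_inv_pspeed (k m a x : R) : 0 < k -> 0 < a < m ->
  continuous (fun t => / pspeed k m a t) x.
Proof.
intros Hk Ha; apply (continuous_ext (fun t => 1 / pspeed k m a t)).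
{ intros t; apply Rmult_1_l. }
apply (continuous_div (fun _ => 1)).
- apply continuous_const.
- now apply continuous_pspeed.
- now apply Rgt_not_eq, pspeed_pos.
Qed.

Lemma inv_pspeed_bounds (k m a x : R) : 0 < k -> 0 < a < m ->
  0 < / pspeed k m a x <= / sqrt (k * (m - a)).
Proof.
intros Hk Ha; split; [now apply Rinv_0_lt_compat, pspeed_pos|].
apply Rinv_le_contravar; [apply sqrt_lt_R0; nra | now apply pspeed_ge].
Qed.

Lemma pspeed_periodic (k m a x : R) : pspeed k m a (x + 2 * PI) = pspeed k m a x.
Proof. unfold pspeed; now rewrite cos_plus, cos_2PI, sin_2PI, Rmult_1_r, Rmult_0_r, Rminus_0_r. Qed.

Lemma RInt_cos_pow2 : RInt (fun x => cos x ^ 2) 0 PI = PI / 2.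
Proof.
apply is_RInt_unique.
replace (PI / 2) with (minus ((PI + sin PI * cos PI) / 2) ((0 + sin 0 * cos 0) / 2)).
2: { unfold minus, plus, opp; simpl; rewrite sin_PI, sin_0; field. }
apply (is_RInt_derive (V := R_CompleteNormedModule) (fun x => (x + sin x * cos x) / 2)).
- intros x _; auto_derive; [easy|].
  assert (H := sin2_cos2 x); unfold Rsqr in H; simpl; lra.
- intros x _; apply continuous_ex_derive; auto_derive; easy.
Qed.

(* Pairing [x] with [x + PI]: the speed is larger where [cos x > 0], so the weight
   [1 / pspeed] favours negative values of [cos]. *)
Lemma lorentzian_RInt_lower (k m a : R) : 0 < k -> 0 < a < m ->
  exists delta, 0 < delta /\ forall tau, 0 < tau <= 1 ->
  delta <= RInt (fun x => - (a * cos x * / pspeed k m a x) / ((a * cos x) ^ 2 + tau ^ 2)) 0 (2 * PI).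
Proof.
intros Hk Ha; assert (HPI := PI_RGT_0).
pose (G := sqrt (k * (m + a))).
assert (HG : 0 < G) by (apply sqrt_lt_R0, Rmult_lt_0_compat; lra).
(* The paired integrands add up to a fraction with numerator [2 * k * a ^ 2 * cos x ^ 2]; [kap]
   arises from bounding both speeds by their maximum [G] and [tau] by 1. *)
pose (kap := k * a ^ 2 / (G ^ 3 * (a ^ 2 + 1))).
assert (HG3 : 0 < G ^ 3) by now apply pow_lt.
assert (Ha2 : 0 < a ^ 2 + 1) by (assert (H := pow2_ge_0 a); lra).
assert (Hkap : 0 < kap) by (apply Rdiv_lt_0_compat; apply Rmult_lt_0_compat; try apply pow_lt; lra).
exists (kap * (PI / 2)); split; [apply Rmult_lt_0_compat; lra|].
intros tau Htau.
pose (h x := - (a * cos x * / pspeed k m a x) / ((a * cos x) ^ 2 + tau ^ 2)).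
assert (Hden : forall x, 0 < (a * cos x) ^ 2 + tau ^ 2)
  by (intros x; assert (H := pow2_ge_0 (a * cos x)); nra).
assert (Hh : forall x, continuous h x).
{ intros x; apply (continuous_div (fun x => - (a * cos x * / pspeed k m a x))).
  - apply (continuous_opp (V := R_NormedModule)), (continuous_mult (K := R_AbsRing));
    [apply continuous_ex_derive; auto_derive; easy | now apply continuous_inv_pspeed].
  - apply continuous_ex_derive; auto_derive; easy.
  - apply Rgt_not_eq, Hden. }
change (kap * (PI / 2) <= RInt h 0 (2 * PI)).
assert (Hshift : RInt h PI (2 * PI) = RInt (fun x => h (x + PI)) 0 PI).
{ replace PI with (1 * 0 + PI) at 1 by ring. replace (2 * PI) with (1 * PI + PI) by ring.
  rewrite <- (RInt_comp_lin (V := R_CompleteNormedModule)).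
  - apply RInt_ext; intros x _; unfold scal; simpl; unfold mult; simpl.
    now rewrite !Rmult_1_l.
  - now apply ex_RInt_cont. }
rewrite <- (RInt_Chasles (V := R_CompleteNormedModule) h 0 PI (2 * PI)) by now apply ex_RInt_cont.
assert (Hh' : forall x, continuous (fun x => h (x + PI)) x).
{ intros x; apply (continuous_comp (fun x => x + PI) h); [|apply Hh].
  apply continuous_ex_derive; auto_derive; easy. }
rewrite Hshift, <- (RInt_plus (V := R_CompleteNormedModule)) by now apply ex_RInt_cont.
rewrite <- RInt_cos_pow2.
assert (Ec : ex_RInt (fun x => cos x ^ 2) 0 PI).
{ apply ex_RInt_cont; intros x; apply continuous_ex_derive; auto_derive; easy. }
change (scal kap (RInt (fun x => cos x ^ 2) 0 PI) <= RInt (fun x => plus (h x) (h (x + PI))) 0 PI).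
rewrite <- (RInt_scal (V := R_CompleteNormedModule)) by easy.
apply RInt_le; [lra | | |].
- now apply (ex_RInt_scal (V := R_NormedModule)).
- apply (ex_RInt_plus (V := R_NormedModule)); now apply ex_RInt_cont.
- intros x _; unfold scal, plus; simpl; unfold mult; simpl.
  change (kap * cos x ^ 2 <= h x + h (x + PI)).
  unfold h; rewrite neg_cos.
  assert (P0 := pspeed_pos k m a x Hk Ha). assert (P1 := pspeed_pos k m a (x + PI) Hk Ha).
  assert (L0 := pspeed_le k m a x Hk Ha). assert (L1 := pspeed_le k m a (x + PI) Hk Ha).
  fold G in L0, L1.
  assert (Q0 : pspeed k m a x ^ 2 = k * (m + a * cos x)).
  { unfold pspeed; apply pow2_sqrt; assert (H := pspeed_arg_pos m a x Ha); nra. }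
  assert (Q1 : pspeed k m a (x + PI) ^ 2 = k * (m - a * cos x)).
  { unfold pspeed; rewrite pow2_sqrt; [rewrite neg_cos; ring|].
    assert (H := pspeed_arg_pos m a (x + PI) Ha); nra. }
  set (g0 := pspeed k m a x) in *. set (g1 := pspeed k m a (x + PI)) in *.
  set (y := cos x) in *.
  assert (Hy : y ^ 2 <= 1) by (assert (H := COS_bound x); fold y in H; nra).
  assert (Hd := Hden x); fold y in Hd.
  (* Rationalizing [g0 - g1] exposes the difference of the squared speeds, which is [2 * k * a * y],
     so the sum acquires the factor [y ^ 2]. *)
  replace (- (a * y * / g0) / ((a * y) ^ 2 + tau ^ 2) + - (a * - y * / g1) / ((a * - y) ^ 2 + tau ^ 2))
    with (a * y * (g0 ^ 2 - g1 ^ 2) / (g0 * g1 * (g0 + g1) * ((a * y) ^ 2 + tau ^ 2)))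
    by (field; repeat split; nra).
  rewrite Q0, Q1.
  replace (a * y * (k * (m + a * y) - k * (m - a * y))) with (2 * k * a ^ 2 * y ^ 2) by ring.
  assert (H01 : 0 < g0 * g1) by now apply Rmult_lt_0_compat.
  assert (H01' : 0 < g0 * g1 * (g0 + g1)) by (apply Rmult_lt_0_compat; lra).
  assert (HD' : 0 < g0 * g1 * (g0 + g1) * ((a * y) ^ 2 + tau ^ 2)) by now apply Rmult_lt_0_compat.
  apply (Rle_div_r _ _ _ HD').
  assert (HGG : g0 * g1 * (g0 + g1) <= 2 * G ^ 3).
  { replace (2 * G ^ 3) with (G * G * (G + G)) by ring.
    apply Rmult_le_compat; [lra | lra | apply Rmult_le_compat; lra | lra]. }
  assert (Hall : g0 * g1 * (g0 + g1) * ((a * y) ^ 2 + tau ^ 2) <= 2 * G ^ 3 * (a ^ 2 + 1)).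
  { apply Rmult_le_compat; [lra | lra | easy | nra]. }
  apply Rle_trans with (kap * y ^ 2 * (2 * G ^ 3 * (a ^ 2 + 1))).
  + apply Rmult_le_compat_l; [|easy]. apply Rmult_le_pos; [lra | apply pow2_ge_0].
  + right; unfold kap; field; split; lra.
Qed.

(** Intermediate values for [J]: the square root kills the second term at [t = 0], and for large [t]
    that term is at least [t / (m + a + t)] times the integral of [w], a factor tending to
    [1 > C]. *)
Lemma subluminal_root (w : R -> R) (C a m K : R) :
  (forall x, continuous w x) -> (forall x, 0 < w x <= K) ->
  0 <= C < 1 -> 0 < a < m ->
  exists t, 0 <= t /\
    RInt (fun x => C * w x - sqrt (t * (t + 2)) * (w x / (m + a * cos x + t))) 0 (2 * PI) = 0.
Proof.
intros Hwc Hw HC Ha; assert (HPI := PI_RGT_0).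
pose (N := RInt w 0 (2 * PI)).
pose (H t := RInt (fun x => w x / (m + a * cos x + t)) 0 (2 * PI)).
pose (J t := sqrt (t * (t + 2)) * H t - C * N).
(* Half the least value of [m + a * cos x]: the denominators stay positive on a two-sided
   neighbourhood of every [t >= 0], including [t = 0]. *)
pose (d := (m - a) / 2). assert (Hd : 0 < d) by (unfold d; lra).
assert (Hden : forall t x, - d < t -> d < m + a * cos x + t).
{ intros t x Ht; assert (H0 := pspeed_arg_pos m a x Ha); unfold d in *; lra. }
assert (Hc : forall t x, - d < t -> continuous (fun x => w x / (m + a * cos x + t)) x).
{ intros t x Ht; apply continuous_div; auto.
  - apply continuous_ex_derive; auto_derive; easy.
  - specialize (Hden t x Ht); lra. }
assert (HN : 0 < N) by (apply RInt_gt_0; auto; [lra | intros; apply Hw]).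
assert (HJ : forall t, 0 <= t ->
  RInt (fun x => C * w x - sqrt (t * (t + 2)) * (w x / (m + a * cos x + t))) 0 (2 * PI) = - J t).
{ intros t Ht; apply is_RInt_unique.
  assert (HJt : minus (scal C N) (scal (sqrt (t * (t + 2))) (H t)) = - J t :> R)
    by (unfold J, minus, plus, opp, scal; simpl; unfold mult; simpl; ring).
  rewrite <- HJt.
  apply (is_RInt_minus (V := R_NormedModule)); apply (is_RInt_scal (V := R_NormedModule)),
    (RInt_correct (V := R_CompleteNormedModule)); apply ex_RInt_cont; auto.
  intros x; apply Hc; lra. }
assert (Jc : forall t, 0 <= t -> continuity_pt J t).
{ intros t Ht; apply (continuity_pt_minus (fun t => sqrt (t * (t + 2)) * H t)).
  - apply (continuity_pt_mult (fun t => sqrt (t * (t + 2)))).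
    (* Differentiability fails at [t = 0], so continuity comes from composition. *)
    + apply (continuity_pt_comp (fun t => t * (t + 2)) sqrt).
      * apply continuity_pt_ex_derive; auto_derive; easy.
      * apply continuity_pt_sqrt; nra.
    + apply (continuity_pt_param_RInt (fun t x => w x / (m + a * cos x + t))
        0 (2 * PI) t (K / (d * d)) d); [lra | easy | |].
      * intros s Hs z; apply Hc; apply Rabs_lt_between in Hs; lra.
      * intros s z Hs; apply Rabs_lt_between in Hs.
        assert (Ds := Hden s z ltac:(lra)). assert (Dt := Hden t z ltac:(lra)).
        replace (w z / (m + a * cos z + s) - w z / (m + a * cos z + t))
          with (- (w z / ((m + a * cos z + s) * (m + a * cos z + t))) * (s - t)) by (field; lra).
        rewrite Rabs_mult, Rabs_Ropp; apply Rmult_le_compat_r; [apply Rabs_pos|].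
        specialize (Hw z).
        assert (Hdd : d * d <= (m + a * cos z + s) * (m + a * cos z + t))
          by (apply Rmult_le_compat; lra).
        rewrite Rabs_right by (apply Rle_ge, Rlt_le, Rdiv_lt_0_compat; nra).
        apply Rmult_le_compat; [lra | | lra | apply Rinv_le_contravar; nra].
        apply Rlt_le, Rinv_0_lt_compat; nra.
  - apply continuity_pt_const; intros x y; reflexivity. }
(* For [C = 0], a standing wave, [J] already vanishes at 0, where the intermediate value theorem
   wants a strict sign. *)
destruct (Rle_lt_or_eq_dec 0 C (proj1 HC)) as [HC0|HC0].
2: { exists 0; split; [lra|]. rewrite HJ by lra; change (- J 0 = 0 :> R); unfold J.
     rewrite Rmult_0_l, sqrt_0, <- HC0; ring. }
(* Solution of [t1 = C * (m + a + t1) + 1], so that [t1 / (m + a + t1)] exceeds [C]. *)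
pose (t1 := (C * (m + a) + 1) / (1 - C)).
assert (Ht1 : 0 < t1) by (apply Rdiv_lt_0_compat; nra).
assert (Hkey : t1 = C * (m + a + t1) + 1) by (unfold t1; field; lra).
assert (H1 : N <= (m + a + t1) * H t1).
{ unfold N, H; rewrite <- (RInt_scal (V := R_CompleteNormedModule))
    by (apply ex_RInt_cont; intros x; apply Hc; lra).
  apply RInt_le; [lra | now apply ex_RInt_cont | |].
  - apply (ex_RInt_scal (V := R_NormedModule)), ex_RInt_cont; intros x; apply Hc; lra.
  - intros x _; unfold scal; simpl; unfold mult; simpl.
    assert (Dx := Hden t1 x ltac:(lra)). specialize (Hw x). assert (B := COS_bound x).
    replace ((m + a + t1) * (w x / (m + a * cos x + t1)))
      with ((m + a + t1) * w x / (m + a * cos x + t1)) by (field; lra).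
    apply Rle_div_r; [lra|]. rewrite Rmult_comm; apply Rmult_le_compat_r; nra. }
assert (H2 : t1 <= sqrt (t1 * (t1 + 2))).
{ rewrite <- (sqrt_pow2 t1) at 1 by lra; apply sqrt_le_1_alt; nra. }
destruct (Ranalysis5.IVT_interv J 0 t1) as [t [Ht Hz]]; auto.
- intros s Hs; apply Jc; lra.
- unfold J; rewrite Rmult_0_l, sqrt_0; nra.
- assert (Hpos : 0 < H t1) by nra.
  assert (C * N <= C * ((m + a + t1) * H t1)) by (apply Rmult_le_compat_l; lra).
  assert (t1 * H t1 <= sqrt (t1 * (t1 + 2)) * H t1) by (apply Rmult_le_compat_r; lra).
  unfold J; nra.
- exists t; split; [lra|]. rewrite HJ, Hz by lra; apply Ropp_0.
Qed.

(** * The phase of a pendulum *)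

Lemma constant_sign (h : R -> R) :
  (forall z, continuous h z) -> (forall z, h z <> 0) ->
  exists eps, eps * eps = 1 /\ forall z, eps * h z = Rabs (h z).
Proof.
intros Hc H0.
assert (Hc' : Ranalysis1.continuity h) by (intros z; apply continuity_pt_filterlim, Hc).
assert (Hsame : forall y, 0 < h 0 * h y).
{ intros y; apply Rnot_le_lt; intros Hle.
  destruct (IVT_gen h 0 y 0 Hc') as [z [_ Hz]]; [|now apply (H0 z)].
  assert (A := H0 0); assert (B := H0 y).
  unfold Rmin, Rmax; destruct (Rle_dec (h 0) (h y)); nra. }
assert (A := H0 0).
destruct (Rlt_le_dec 0 (h 0)) as [Hp|Hn].
- exists 1; split; [ring|]; intros z; specialize (Hsame z); rewrite Rabs_right; nra.
- exists (-1); split; [ring|]; intros z; specialize (Hsame z); rewrite Rabs_left; nra.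
Qed.

(** For [E > 2] the energy identity keeps [F1] away from 0, so [F] is monotone and serves as its own
    phase, up to a sign that makes it increase. *)
Lemma rotational_phase (F F1 : R -> R) (k E : R) :
  0 < k -> 2 < E ->
  (forall z, is_derive F z (F1 z)) -> (forall z, continuous F1 z) ->
  (forall z, F1 z ^ 2 = k * (E - 1 + cos (F z))) ->
  exists theta, forall z, is_derive theta z (pspeed k (E - 1) 1 (theta z)) /\
    cos (F z) = 1 - 1 + 1 * cos (theta z).
Proof.
intros Hk HE HF Hc H1.
destruct (constant_sign F1 Hc) as [eps [Heps Hs]].
{ intros z H; specialize (H1 z); rewrite H in H1; assert (B := COS_bound (F z)); nra. }
assert (Hcos : forall z, cos (eps * F z) = cos (F z)).
{ intros z; assert (Heps' : (eps - 1) * (eps + 1) = 0) by lra.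
  apply Rmult_integral in Heps'; destruct Heps' as [He|He].
  - replace eps with 1 by lra; now rewrite Rmult_1_l.
  - replace eps with (-1) by lra; replace (-1 * F z) with (- F z) by ring; apply cos_neg. }
exists (fun z => eps * F z); intros z; split; [|rewrite Hcos; ring].
replace (pspeed k (E - 1) 1 (eps * F z)) with (eps * F1 z).
- apply is_derive_scal, HF.
- unfold pspeed; rewrite Hcos, Rmult_1_l, <- H1, Hs, <- pow2_abs.
  symmetry; apply sqrt_pow2, Rabs_pos.
Qed.

Lemma exists_angle (u v : R) : u ^ 2 + v ^ 2 = 1 -> exists psi, sin psi = u /\ cos psi = v.
Proof.
intros H.
assert (Hv : -1 <= v <= 1) by nra.
assert (Hsq : sqrt (1 - v²) = Rabs u).
{ replace (1 - v²) with (u ^ 2) by (unfold Rsqr; lra).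
  rewrite <- pow2_abs; apply sqrt_pow2, Rabs_pos. }
destruct (Rle_lt_dec 0 u) as [Hu|Hu].
- exists (acos v); rewrite sin_acos, cos_acos, Hsq, Rabs_right by lra; easy.
- exists (- acos v); rewrite sin_neg, cos_neg, sin_acos, cos_acos, Hsq, Rabs_left by lra.
  split; [ring | easy].
Qed.

(** The point [(v, u)] turns with angular velocity [q]. Let [psi] be a primitive of [q] starting at
    the right angle; in the frame rotated by [psi] the coordinates of the point are constant. *)
Lemma rotation_lift (u v q : R -> R) :
  (forall z, continuous q z) ->
  (forall z, is_derive u z (q z * v z)) -> (forall z, is_derive v z (- q z * u z)) ->
  u 0 ^ 2 + v 0 ^ 2 = 1 ->
  exists psi, forall z, is_derive psi z (q z) /\ u z = sin (psi z).
Proof.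
intros Hq Hu Hv H0; destruct (exists_angle _ _ H0) as [psi0 [Hs Hc]].
pose (psi z := psi0 + RInt q 0 z).
assert (Hpsi : forall z, is_derive psi z (q z)).
{ intros z; unfold psi; replace (q z) with (plus 0 (q z)) by (unfold plus; simpl; ring).
  apply (is_derive_plus (V := R_NormedModule) (fun _ => psi0) (RInt q 0)).
  - apply (is_derive_const (V := R_NormedModule)).
  - now apply is_derive_RInt_0. }
assert (Hpsi0 : psi 0 = psi0).
{ unfold psi; rewrite (RInt_point (V := R_CompleteNormedModule)).
  unfold zero; simpl; ring. }
exists psi; intros z; split; [apply Hpsi|].
assert (HP : u z * cos (psi z) - v z * sin (psi z) = 0).
{ rewrite (derive_zero_const (fun z => u z * cos (psi z) - v z * sin (psi z))) with (y := 0).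
  - rewrite Hpsi0, Hs, Hc; ring.
  - intros x; auto_derive; [repeat split;
      [eexists; apply Hu | eexists; apply Hpsi | eexists; apply Hv | eexists; apply Hpsi]|].
    derive_subst (Hu x); derive_subst (Hv x); derive_subst (Hpsi x); ring. }
assert (HQ : u z * sin (psi z) + v z * cos (psi z) = 1).
{ rewrite (derive_zero_const (fun z => u z * sin (psi z) + v z * cos (psi z))) with (y := 0).
  - rewrite Hpsi0, Hs, Hc, <- H0; ring.
  - intros x; auto_derive; [repeat split;
      [eexists; apply Hu | eexists; apply Hpsi | eexists; apply Hv | eexists; apply Hpsi]|].
    derive_subst (Hu x); derive_subst (Hv x); derive_subst (Hpsi x); ring. }
assert (H1 := sin2_cos2 (psi z)); unfold Rsqr in H1.
transitivity (u z * (sin (psi z) * sin (psi z) + cos (psi z) * cos (psi z))); [rewrite H1; ring|].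
transitivity ((u z * sin (psi z) + v z * cos (psi z)) * sin (psi z)
  + (u z * cos (psi z) - v z * sin (psi z)) * cos (psi z)); [ring|].
rewrite HP, HQ; ring.
Qed.

(* Amplitude variable [psi]: [sin (F / 2) = sqrt (E / 2) * sin psi] with
   [psi' = sqrt g * cos (F / 2)]; the phase is [theta = +- 2 psi]. *)
Lemma librational_phase (F F1 : R -> R) (g E : R) :
  0 < g -> 0 < E < 2 ->
  (forall z, is_derive F z (F1 z)) -> (forall z, is_derive F1 z (- g * sin (F z))) ->
  (forall z, F1 z ^ 2 = 2 * g * (E - 1 + cos (F z))) ->
  exists theta, forall z, is_derive theta z (pspeed (2 * g) (2 - E / 2) (E / 2) (theta z)) /\
    cos (F z) = 1 - E / 2 + E / 2 * cos (theta z).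
Proof.
intros Hg HE HF HF1 Hen.
pose (kap := sqrt (E / 2)). pose (G := sqrt g).
assert (Hkap : 0 < kap) by (apply sqrt_lt_R0; lra).
assert (Hkap2 : kap ^ 2 = E / 2) by (apply pow2_sqrt; lra).
assert (HG : 0 < G) by now apply sqrt_lt_R0.
assert (HG2 : G ^ 2 = g) by (apply pow2_sqrt; lra).
assert (Hhalf : forall z, cos (F z) = 1 - 2 * sin (F z / 2) ^ 2
  /\ sin (F z) = 2 * sin (F z / 2) * cos (F z / 2)
  /\ sin (F z / 2) ^ 2 + cos (F z / 2) ^ 2 = 1).
{ intros z; replace (F z) with (2 * (F z / 2)) at 1 3 by field.
  rewrite cos_2a_sin, sin_2a; assert (H := sin2_cos2 (F z / 2)); unfold Rsqr in H.
  repeat split; lra. }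
pose (q z := G * cos (F z / 2)).
assert (Hqc : forall z, continuous q z).
{ intros z; apply continuous_ex_derive; unfold q; auto_derive; eexists; apply HF. }
(* A zero of [cos (F / 2)] means [cos F = -1], where the energy identity gives
   [F1 ^ 2 = 2 * g * (E - 2) < 0]. *)
assert (Hq0 : forall z, q z <> 0).
{ intros z H; unfold q in H; apply Rmult_integral in H; destruct H as [H|H]; [lra|].
  destruct (Hhalf z) as [H1 [_ H2]]; rewrite H in H2.
  specialize (Hen z); assert (H3 := pow2_ge_0 (F1 z)); nra. }
(* These are [sin psi] and [cos psi]; the energy identity says that they lie on the unit circle. *)
destruct (rotation_lift (fun z => sin (F z / 2) / kap) (fun z => F1 z / (2 * G * kap)) q) as [psi Hpsi].
- exact Hqc.
- intros z; auto_derive; [eexists; apply HF|].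
  derive_subst (HF z); unfold q; change (F z * / 2) with (F z / 2); field; lra.
- intros z; auto_derive; [eexists; apply HF1|].
  derive_subst (HF1 z); destruct (Hhalf z) as [_ [-> _]]; unfold q; rewrite <- HG2; field; lra.
- replace ((sin (F 0 / 2) / kap) ^ 2 + (F1 0 / (2 * G * kap)) ^ 2)
    with (sin (F 0 / 2) ^ 2 / kap ^ 2 + F1 0 ^ 2 / (4 * G ^ 2 * kap ^ 2)) by (field; lra).
  destruct (Hhalf 0) as [H1 _]; rewrite Hen, H1, Hkap2, HG2; field; lra.
- destruct (constant_sign q Hqc Hq0) as [eps [Heps Hs]].
  assert (Hcos : forall z, cos (eps * (2 * psi z)) = 1 - 4 / E * sin (F z / 2) ^ 2).
  { intros z; transitivity (cos (2 * psi z)).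
    - assert (Heps' : (eps - 1) * (eps + 1) = 0) by lra.
      apply Rmult_integral in Heps'; destruct Heps' as [He|He].
      + replace eps with 1 by lra; now rewrite Rmult_1_l.
      + replace eps with (-1) by lra; rewrite <- cos_neg; f_equal; ring.
    - rewrite cos_2a_sin; destruct (Hpsi z) as [_ <-].
      replace (2 * (sin (F z / 2) / kap) * (sin (F z / 2) / kap))
        with (2 * sin (F z / 2) ^ 2 / kap ^ 2) by (field; lra).
      rewrite Hkap2; field; lra. }
  exists (fun z => eps * (2 * psi z)); intros z; rewrite Hcos.
  destruct (Hhalf z) as [H1 [_ H2]]; split; [|rewrite H1; field; lra].
  replace (pspeed (2 * g) (2 - E / 2) (E / 2) (eps * (2 * psi z))) with (eps * (2 * q z)).
  + apply (is_derive_scal (fun z => 2 * psi z)).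
    apply (is_derive_scal psi), Hpsi.
  + replace (eps * (2 * q z)) with (2 * (eps * q z)) by ring; rewrite Hs.
    unfold pspeed; rewrite Hcos.
    replace (2 * g * (2 - E / 2 + E / 2 * (1 - 4 / E * sin (F z / 2) ^ 2)))
      with ((2 * Rabs (q z)) ^ 2).
    * symmetry; apply sqrt_pow2; assert (H := Rabs_pos (q z)); lra.
    * rewrite Rpow_mult_distr, pow2_abs; unfold q; rewrite Rpow_mult_distr, HG2.
      replace (cos (F z / 2) ^ 2) with (1 - sin (F z / 2) ^ 2) by lra; field; lra.
Qed.

(** * Instability *)

Lemma sign_exists (c : R) : exists eps, eps * eps = 1 /\ c = eps * Rabs c.
Proof.
destruct (Rle_lt_dec 0 c) as [H|H].
- exists 1; rewrite Rabs_right by lra; split; ring.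
- exists (-1); rewrite Rabs_left by lra; split; ring.
Qed.

Lemma energy_derive_pow2 (c : R) (f : R -> R) (E : R) :
  c ^ 2 <> 1 -> has_energy c f E ->
  forall z, Derive f z ^ 2 = 2 * gam c * (E - 1 + cos (f z)).
Proof.
intros Hc HE z; specialize (HE z); unfold gam; rewrite <- HE; field; lra.
Qed.

(** The first alternative is the rotational wave, the second the librational one. With
    [b = a - 1 + i tau] one gets [X = a cos theta + i tau], [2 g lam^2 = - mu + i tau], and in both
    cases [W^2 = 2 g (a^2 + tau^2) (m - i tau)]. *)
Lemma superluminal_unstable (c : R) (f theta : R -> R) (E a m mu : R) :
  1 < c ^ 2 -> traveling_wave c f -> has_energy c f E ->
  0 < a < m -> E = a + mu -> (mu = m /\ a = 1) \/ (mu = a /\ m = 2 - a) ->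
  (forall z, is_derive theta z (pspeed (2 * gam c) m a (theta z)) /\
    cos (f z) = 1 - a + a * cos (theta z)) ->
  ~ spectrally_stable c f.
Proof.
intros Hc Hf HE Ha HEa Hcase Hth.
set (g := gam c) in *.
assert (Hg : 0 < g) by (apply Rinv_0_lt_compat; lra).
assert (Hmu : 0 < mu <= m) by lra.
assert (Hk : 0 < 2 * g) by lra.
pose (w x := / pspeed (2 * g) m a x).
destruct (lorentzian_RInt_lower (2 * g) m a Hk Ha) as [delta [Hdelta HD]].
assert (HC : 1 < Rabs c).
{ apply Rnot_le_lt; intros H; rewrite <- pow2_abs in Hc; assert (H0 := Rabs_pos c); nra. }
destruct (superluminal_root w (Rabs c) a m mu delta (/ sqrt (2 * g * (m - a)))) as [tau [Htau Hroot]]; auto.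
{ intros x; now apply continuous_inv_pspeed. }
{ intros x; now apply inv_pspeed_bounds. }
{ lra. }
destruct (sign_exists c) as [eps [Heps Hceps]].
pose (r := sqrt (2 * g)).
assert (Hr : 0 < r) by now apply sqrt_lt_R0.
assert (Hr2 : r ^ 2 = 2 * g) by (apply pow2_sqrt; lra).
pose (P := sqrt (a ^ 2 + tau ^ 2)).
assert (HP2 : P ^ 2 = a ^ 2 + tau ^ 2) by (apply pow2_sqrt; nra).
set (s1 := sqrt_re m tau) in *. set (s2 := sqrt_im m tau) in *.
pose (l1 := sqrt_re mu tau). pose (l2 := sqrt_im mu tau).
assert (Hs12 : s2 ^ 2 - s1 ^ 2 = m) by (unfold s1, s2; rewrite sqrt_re_pow2, sqrt_im_pow2 by lra; field).
assert (Hs : 2 * s1 * s2 = tau) by (apply sqrt_re_im; lra).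
assert (Hl12 : l2 ^ 2 - l1 ^ 2 = mu) by (unfold l1, l2; rewrite sqrt_re_pow2, sqrt_im_pow2 by lra; field).
assert (Hl : 2 * l1 * l2 = tau) by (apply sqrt_re_im; lra).
assert (Hl1 : 0 < l1) by (apply sqrt_re_pos; lra).
fold P l1 in Hroot.
(* Integrand of the exponent as a function of the phase. [W] is a multiple of [s2 - i s1], a square
   root of [m - i tau]; its free sign [eps] is taken from [c], so that the two contributions to the
   mean can cancel. *)
pose (h x := c * g * (l1 / r)
  + (2 * eps * g * (P / r) * s2 * (a * cos x) + - (2 * eps * g * (P / r) * s1) * tau)
    / (2 * ((a * cos x) ^ 2 + tau ^ 2))).
assert (Hden : forall x, 0 < (a * cos x) ^ 2 + tau ^ 2)
  by (intros x; assert (H := pow2_ge_0 (a * cos x)); nra).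
destruct (bounded_composed_primitive theta (pspeed (2 * g) m a) h) as (S & M & HS & HM).
- apply Hth.
- intros x; now apply pspeed_pos.
- intros x; now apply continuous_pspeed.
- intros x; apply continuous_ex_derive; unfold h; auto_derive.
  specialize (Hden x); simpl in Hden; lra.
- intros x; unfold h; now rewrite pspeed_periodic, cos_plus, cos_2PI, sin_2PI,
    Rmult_1_r, Rmult_0_r, Rminus_0_r.
- refine (eq_trans _ (eq_trans (f_equal (Rmult (g * eps / r)) Hroot) (Rmult_0_r _))).
  rewrite <- (RInt_scal (V := R_CompleteNormedModule) _ _ _ (g * eps / r)).
  + apply RInt_ext; intros x _; unfold scal; simpl; unfold mult; simpl; unfold h, w.
    assert (H := pspeed_pos (2 * g) m a x Hk Ha); specialize (Hden x).
    rewrite Hceps at 1; field; simpl in Hden; repeat split; lra.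
  + apply ex_RInt_cont; intros x.
    assert (Hwc : continuous w x) by now apply continuous_inv_pspeed.
    apply (continuous_minus (V := R_NormedModule)).
    * apply (continuous_scal_r (V := R_NormedModule) (Rabs c * l1) w), Hwc.
    * apply (continuous_scal_r (V := R_NormedModule) P
        (fun x => (s1 * tau - s2 * (a * cos x)) / ((a * cos x) ^ 2 + tau ^ 2) * w x)).
      apply (continuous_mult (K := R_AbsRing)); [|exact Hwc].
      apply continuous_ex_derive; auto_derive; specialize (Hden x); simpl in Hden; lra.
- pose (lam := (l1 / r, l2 / r) : C).
  pose (W := (2 * eps * g * (P / r) * s2, - (2 * eps * g * (P / r) * s1)) : C).
  intros Hst; specialize (Hst lam).
  assert (0 < l1 / r) by now apply Rdiv_lt_0_compat.
  enough (in_spectrum c f lam) by (specialize (Hst H0); simpl in Hst; lra).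
  assert (Hll : (lam * lam)%C = (- mu / (2 * g), tau / (2 * g))).
  { unfold lam, Cmult; simpl; f_equal.
    - replace (l1 / r * (l1 / r) - l2 / r * (l2 / r)) with (- (l2 ^ 2 - l1 ^ 2) / r ^ 2) by (field; lra).
      now rewrite Hl12, Hr2.
    - replace (l1 / r * (l2 / r) + l2 / r * (l1 / r)) with (2 * l1 * l2 / r ^ 2) by (field; lra).
      now rewrite Hl, Hr2. }
  apply (in_spectrum_of_exponent c f E lam ((a - 1)%R, tau) W S M); fold g; auto.
  + lra.
  + rewrite Hll; apply injective_projections; simpl; rewrite ?HEa; field; lra.
  + rewrite Hll.
    assert (HWW : (W * W)%C
       = (2 * g * (a ^ 2 + tau ^ 2) * m, - (2 * g * (a ^ 2 + tau ^ 2) * tau))).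
    { unfold W, Cmult; simpl; f_equal.
      - match goal with |- ?x = _ =>
          replace x with ((eps * eps) * (4 * g ^ 2 * P ^ 2) * (s2 ^ 2 - s1 ^ 2) / r ^ 2) by (field; lra) end.
        rewrite Heps, HP2, Hs12, Hr2; field; lra.
      - match goal with |- ?x = _ =>
          replace x with (- ((eps * eps) * (4 * g ^ 2 * P ^ 2) * (2 * s1 * s2) / r ^ 2)) by (field; lra) end.
        rewrite Heps, HP2, Hs, Hr2; field; lra. }
    rewrite HWW.
    (* In [(- mu + i tau) (a + i tau) (a - 2 + i tau)] two factors multiply to [- (a^2 + tau^2)]:
       the last two when [a = 1], the first two when [mu = a]. *)
    destruct Hcase as [[-> ->] | [-> ->]]; apply injective_projections; simpl; field; lra.
  + intros z; destruct (Hth z) as [_ ->]; simpl.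
    replace (1 - a + a * cos (theta z) + (a - 1)) with (a * cos (theta z)) by ring.
    specialize (Hden (theta z)); simpl in Hden; lra.
  + intros z; destruct (Hth z) as [_ ->]; simpl (Re _); simpl (Im _).
    replace (1 - a + a * cos (theta z) + (a - 1)) with (a * cos (theta z)) by ring.
    apply HS.
Qed.

(** With [b = - 1 - t] everything is real: [X = - (m + a cos theta + t)] has no zeros and
    [b^2 - 1 = t (t + 2)], so the exponent has zero mean at the root found for [Rabs c]. *)
Lemma subluminal_unstable (c : R) (f theta : R -> R) (E a m : R) :
  c ^ 2 < 1 -> traveling_wave c f -> has_energy c f E ->
  0 < a < m -> 0 < E -> a = 1 - E / 2 -> m = 2 - a ->
  (forall z, is_derive theta z (pspeed (- (2 * gam c)) m a (theta z)) /\
    cos (f z) = - (1 - a + a * cos (theta z))) ->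
  ~ spectrally_stable c f.
Proof.
intros Hc Hf HE Ha HE0 HaE Hm Hth.
set (g := gam c) in *.
assert (Hg : g < 0) by (apply Rinv_lt_0_compat; lra).
assert (Hk : 0 < - (2 * g)) by lra.
pose (w x := / pspeed (- (2 * g)) m a x).
assert (HC : 0 <= Rabs c < 1).
{ assert (H0 := Rabs_pos c); split; [easy|].
  apply Rnot_le_lt; intros H; rewrite <- pow2_abs in Hc; nra. }
destruct (subluminal_root w (Rabs c) a m (/ sqrt (- (2 * g) * (m - a)))) as [t [Ht Hroot]]; auto.
{ intros x; now apply continuous_inv_pspeed. }
{ intros x; now apply inv_pspeed_bounds. }
destruct (sign_exists c) as [eps [Heps Hceps]].
(* From [2 g lam^2 = b - E + 1 = - (E + t)]; [g < 0] makes this root real and positive. *)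
pose (l := sqrt ((E + t) / - (2 * g))).
assert (Hl : 0 < l) by (apply sqrt_lt_R0, Rdiv_lt_0_compat; lra).
assert (Hl2 : l * l = (E + t) / - (2 * g)).
{ apply sqrt_sqrt, Rlt_le, Rdiv_lt_0_compat; lra. }
pose (s := sqrt (t * (t + 2))). fold s in Hroot.
assert (Hs2 : s * s = t * (t + 2)) by (apply sqrt_sqrt; nra).
pose (W := 2 * eps * g * l * s).
assert (Hpos : forall x, 0 < m + a * cos x + t)
  by (intros x; assert (H := pspeed_arg_pos m a x Ha); lra).
pose (h x := c * g * l + W * - (m + a * cos x + t) / (2 * (m + a * cos x + t) ^ 2)).
destruct (bounded_composed_primitive theta (pspeed (- (2 * g)) m a) h) as (S & M & HS & HM).
- apply Hth.
- intros x; now apply pspeed_pos.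
- intros x; now apply continuous_pspeed.
- intros x; apply continuous_ex_derive; unfold h; auto_derive; specialize (Hpos x); nra.
- intros x; unfold h; now rewrite pspeed_periodic, cos_plus, cos_2PI, sin_2PI,
    Rmult_1_r, Rmult_0_r, Rminus_0_r.
- refine (eq_trans _ (eq_trans (f_equal (Rmult (g * l * eps)) Hroot) (Rmult_0_r _))).
  rewrite <- (RInt_scal (V := R_CompleteNormedModule) _ _ _ (g * l * eps)).
  + apply RInt_ext; intros x _; unfold scal; simpl; unfold mult; simpl; unfold h, w, W.
    assert (H := pspeed_pos (- (2 * g)) m a x Hk Ha); specialize (Hpos x).
    rewrite Hceps at 1; field; simpl; repeat split; lra.
  + apply ex_RInt_cont; intros x.
    assert (Hwc : continuous w x) by now apply continuous_inv_pspeed.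
    apply (continuous_minus (V := R_NormedModule)).
    * apply (continuous_scal_r (V := R_NormedModule) (Rabs c) w), Hwc.
    * apply (continuous_scal_r (V := R_NormedModule) s (fun x => w x / (m + a * cos x + t))).
      apply continuous_div; [exact Hwc | | specialize (Hpos x); lra].
      apply continuous_ex_derive; auto_derive; easy.
- intros Hst; specialize (Hst (RtoC l)).
  enough (in_spectrum c f (RtoC l)) by (specialize (Hst H); simpl in Hst; lra).
  apply (in_spectrum_of_exponent c f E _ (RtoC (- 1 - t)) (RtoC W) S M); fold g; auto.
  + lra.
  + rewrite <- RtoC_mult, Hl2, <- RtoC_mult, <- RtoC_plus; f_equal; field; lra.
  + rewrite <- !RtoC_mult, <- RtoC_minus, <- RtoC_mult; f_equal.
    replace (W * W) with ((eps * eps) * (4 * g ^ 2) * (l * l) * (s * s)) by (unfold W; ring).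
    rewrite Heps, Hs2; ring.
  + intros z; destruct (Hth z) as [_ ->]; simpl; specialize (Hpos (theta z)); rewrite Hm in Hpos; nra.
  + intros z; destruct (Hth z) as [_ ->]; simpl (Re _); simpl (Im _).
    replace (W * (- (1 - a + a * cos (theta z)) + (-1 - t)) + 0 * 0)
      with (W * - (m + a * cos (theta z) + t)) by (rewrite Hm; ring).
    replace ((- (1 - a + a * cos (theta z)) + (-1 - t)) ^ 2 + 0 ^ 2)
      with ((m + a * cos (theta z) + t) ^ 2) by (rewrite Hm; ring).
    apply HS.
Qed.

Theorem theorem1p10 (c : R) (f : R -> R) (E : R) :
  c ^ 2 <> 1 ->
  traveling_wave c f ->
  has_energy c f E ->
  periodic_tw c E ->
  ((subluminal c /\ rotational c E) -> spectrally_stable c f) /\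
  ((superluminal c /\ rotational c E) -> ~ spectrally_stable c f) /\
  (librational E -> ~ spectrally_stable c f).
Proof.
intros Hc Hf HE _.
assert (Hf' := traveling_wave_derive c f Hc Hf).
assert (Hen := energy_derive_pow2 c f E Hc HE).
unfold rotational, subluminal, superluminal, librational.
split; [|split].
- intros [H1 [H2 | H2]]; [|lra]; apply (subluminal_rotational_stable c f E); auto; lra.
- intros [H1 [H2 | H2]]; [lra|].
  assert (Hg : 0 < gam c) by (apply Rinv_0_lt_compat; lra).
  destruct (rotational_phase f (Derive f) (2 * gam c) E) as [theta Hth]; auto; try lra.
  + apply Hf'.
  + intros z; apply continuous_ex_derive; eexists; apply Hf'.
  + apply (superluminal_unstable c f theta E 1 (E - 1) (E - 1)); auto; lra.
- intros HE2; destruct (Rlt_le_dec 1 (c ^ 2)) as [H1|H1].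
  + assert (Hg : 0 < gam c) by (apply Rinv_0_lt_compat; lra).
    destruct (librational_phase f (Derive f) (gam c) E) as [theta Hth]; auto; try apply Hf'.
    apply (superluminal_unstable c f theta E (E / 2) (2 - E / 2) (E / 2)); auto; lra.
  + assert (Hg : gam c < 0) by (apply Rinv_lt_0_compat; lra).
    (* The shift by [PI] turns a subluminal libration into a pendulum with positive constant
       [- gam c] and energy [2 - E], to which the amplitude variable applies. *)
    assert (Hcs : forall z, cos (f z + PI) = - cos (f z) /\ sin (f z + PI) = - sin (f z))
      by (intros z; split; [apply neg_cos | apply neg_sin]).
    destruct (librational_phase (fun z => f z + PI) (Derive f) (- gam c) (2 - E)) as [theta Hth].
    * lra.
    * lra.
    * intros z; destruct (Hf' z) as [H2 _]; auto_derive; [eexists; apply H2|].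
      derive_subst H2; ring.
    * intros z; destruct (Hcs z) as [_ ->].
      replace (- - gam c * - sin (f z)) with (- gam c * sin (f z)) by ring; apply Hf'.
    * intros z; destruct (Hcs z) as [-> _]; rewrite Hen; ring.
    * apply (subluminal_unstable c f theta E ((2 - E) / 2) (2 - (2 - E) / 2)); auto; try lra.
      intros z; destruct (Hth z) as [H2 H3]; destruct (Hcs z) as [H4 _]; split; [|lra].
      now replace (- (2 * gam c)) with (2 * - gam c) by ring.
Qed.
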